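(* Let $n\in\mathbb{N}$, fix $0<\alpha<n$, $1<p<n/\alpha$, and set $q:=np/(n-\alpha p)$. Let $E\subset\mathbb{R}^n$ be a median porous set with $0<\operatorname{diam}(E)<\infty$. Consider exponents $\beta_1,\beta_2\in\mathbb{R}$ satisfying $$-\beta_2=-\frac{q}{p}\beta_1\in I_\infty(E)\qquad\text{and}\qquad\frac{\beta_1}{p-1}\in I_\infty(E).$$ Then there exists $C>0$, depending only on $\beta_1,\beta_2,\alpha,p,n$, and $E$, such that $$\left(\int_{\mathbb{R}^n}|I_\alpha(f)(x)|^q\,d(x,E)^{\beta_2}\,dx\right)^{1/q}\le C\left(\int_{\mathbb{R}^n}|f(x)|^p\,d(x,E)^{\beta_1}\,dx\right)^{1/p}$$ for every measurable function $f$.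
   Context: Here $d(x,E)=\inf\{|x-y|:y\in E\}$ and $\operatorname{diam}(E)=\sup\{|x-y|:x,y\in E\}$. The fractional integral operator is $I_\alpha(f)(x)=\int_{\mathbb{R}^n}\frac{f(y)}{|x-y|^{n-\alpha}}\,dy$. The class $A_\infty(\mathbb{R}^n)$ consists of the weights $w$ (i.e. $w\in L^1_{\rm loc}(\mathbb{R}^n)$, $w\ge0$ a.e.) with $\sup_Q\left(\frac{1}{|Q|}\int_Q w\right)\exp\left(-\frac{1}{|Q|}\int_Q\ln w\right)<\infty$, the supremum over all cubes $Q\subset\mathbb{R}^n$. For nonempty $E\subset\mathbb{R}^n$ set $I_\infty(E):=\{\beta\in\mathbb{R}: d(\cdot,E)^{-\beta}\in A_\infty(\mathbb{R}^n)\}$; $E$ is called median porous if there exists $\beta>0$ with $d(\cdot,E)^{-\beta}\in A_\infty(\mathbb{R}^n)$. *)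

(* Defs.v *)
From HB Require Import structures.
From mathcomp Require Import all_boot all_order all_algebra.
From mathcomp Require Import all_classical all_reals all_analysis.
From mathcomp Require Import measurable_realfun.
Import Order.TTheory GRing.Theory Num.Theory.
Import numFieldNormedType.Exports.

Set Implicit Arguments.
Unset Strict Implicit.
Unset Printing Implicit Defensive.

Local Open Scope classical_set_scope.
Local Open Scope ring_scope.

(* The library has no n-dimensional Lebesgue measure. On the Borel sets of R^n
   (n.-tuple R with the sigma-algebra generated by the coordinates) it is the
   n-fold product of the one-dimensional Lebesgue measure, built by recursion
   on n; [lebesgue_Rn] below is its completion. *)
Section borel_lebesgue.
Variable R : realType.
Local Notation TR := (measurableTypeR R).

Definition tcons n (x : TR * n.-tuple TR) : n.+1.-tuple TR :=
  [tuple of x.1 :: x.2].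

Lemma measurable_tcons n : measurable_fun [set: TR * n.-tuple TR] (@tcons n).
Proof. exact: (measurable_cons measurable_fst measurable_snd). Qed.

Section step.
Variables (n : nat) (mu : {sigma_finite_measure set (n.-tuple TR) -> \bar R}).

Definition cons_measure : set (n.+1.-tuple TR) -> \bar R :=
  pushforward (@lebesgue_measure R \x mu)%E (@tcons n).

Let cons_measure0 : cons_measure set0 = 0%E.
Proof. by rewrite /cons_measure /pushforward preimage_set0 measure0. Qed.

Let cons_measure_ge0 A : (0 <= cons_measure A)%E.
Proof. by rewrite /cons_measure /pushforward measure_ge0. Qed.

Let cons_measure_sigma_additive : semi_sigma_additive cons_measure.
Proof.
move=> F mF tF mUF; rewrite /cons_measure /pushforward preimage_bigcup.
apply: measure_semi_sigma_additive.
- by move=> k; rewrite -[X in measurable X]setTI; exact: measurable_tcons.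
- apply/trivIsetP => /= i j _ _ ij; rewrite -preimage_setI.
  by move/trivIsetP : tF => /(_ _ _ _ _ ij) ->//; rewrite preimage_set0.
- by rewrite -preimage_bigcup -[X in measurable X]setTI; exact: measurable_tcons.
Qed.

HB.instance Definition _ := isMeasure.Build _ _ _ cons_measure
  cons_measure0 cons_measure_ge0 cons_measure_sigma_additive.

Let cons_measure_sigma_finite : sigma_finite setT cons_measure.
Proof.
have [F TF [ndF Foo]] : exists2 F : (set TR)^nat, setT = \bigcup_k F k &
    nondecreasing_seq F /\
    forall k, measurable (F k) /\ (@lebesgue_measure R (F k) < +oo)%E.
  by have /sigma_finiteP[F [? ? ?]] := sigma_finiteT (@lebesgue_measure R); exists F.
have /sigma_finiteP[G [TG ndG Goo]] := sigma_finiteT mu.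
pose u (t : n.+1.-tuple TR) : TR * n.-tuple TR := (thead t, [tuple of behead t]).
have Ku x : u (tcons x) = x.
  by case: x => x t; congr (_, _); apply: val_inj.
have mu_ : measurable_fun setT u.
  apply: measurable_fun_pair; first exact: measurable_tnth.
  apply/measurable_fun_tnthP => i /=.
  rewrite (_ : _ \o _ = @tnth _ TR ^~ (lift ord0 i)); first exact: measurable_tnth.
  by apply/funext => t /=; rewrite [in RHS](tuple_eta t) tnthS.
exists (fun k => u @^-1` (F k `*` G k)).
  rewrite -preimage_bigcup (_ : \bigcup_k _ = setT) ?preimage_setT//.
  rewrite -subTset => -[x t] _.
  have [i _ Fx] : (\bigcup_k F k) x by rewrite -TF.
  have [j _ Gt] : (\bigcup_k G k) t by rewrite -TG.
  exists (maxn i j) => //; split => /=.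
  - by move: x Fx; exact/subsetPset/ndF/leq_maxl.
  - by move: t Gt; exact/subsetPset/ndG/leq_maxr.
move=> k; have [mF Fk] := Foo k; have [mG Gk] := Goo k; split.
  by rewrite -[X in measurable X]setTI; apply: mu_ => //; exact: measurableX.
rewrite /cons_measure /pushforward -comp_preimage (_ : u \o _ = id); last first.
  by apply/funext => x /=; rewrite Ku.
by rewrite preimage_id product_measure1E// lte_mul_pinfty// ge0_fin_numE.
Qed.

HB.instance Definition _ := Measure_isSigmaFinite.Build _ _ _ cons_measure
  cons_measure_sigma_finite.

End step.

Fixpoint borel_lebesgue n : {sigma_finite_measure set (n.-tuple TR) -> \bar R} :=
  match n with
  | 0 => dirac [tuple]
  | n'.+1 => cons_measure (borel_lebesgue n')
  end.

End borel_lebesgue.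

Section euclidean.
Variables (R : realType) (n : nat).
Local Notation borel := (@borel_lebesgue R n).

(* R^n, with the sigma-algebra of Lebesgue measurable sets. *)
Definition Rn := caratheodory_type (borel^*)%mu.
HB.instance Definition _ := Measurable.on Rn.

Definition lebesgue_Rn : set Rn -> \bar R :=
  @completed_measure_extension _ _ _ borel.
HB.instance Definition _ := Measure.on lebesgue_Rn.
HB.instance Definition _ := Measure_isSigmaFinite.Build _ _ _ lebesgue_Rn
  (completed_measure_extension_sigma_finite (sigma_finiteT borel)).

End euclidean.
Arguments lebesgue_Rn {R n}.

Section distance.
Variables (R : realType) (n : nat).
Implicit Types (x y : Rn R n) (E : set (Rn R n)).

Definition coord x (i : 'I_n) : R := tnth x i.

Definition eucl_dist x y : R :=
  Num.sqrt (\sum_(i < n) (coord x i - coord y i) ^+ 2).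

(* Used for nonempty [E] only: the infimum of the empty set is 0 here. *)
Definition dist_set x E : R := inf [set eucl_dist x y | y in E].

(* The diameter of the empty set is -oo here. *)
Definition diameter E : \bar R :=
  ereal_sup [set (eucl_dist x y)%:E | x in E & y in E].

End distance.

(* [t ^ s] for [0 <= t], with [0 ^ s = +oo] when [s < 0]; the library's [powR]
   has [0 `^ s = 0] in that case. *)
Definition epowR (R : realType) (t s : R) : \bar R :=
  if (t == 0) && (s < 0) then +oo%E else (t `^ s)%:E.

Section weights.
Variables (R : realType) (n : nat).
Local Notation T := (Rn R n).
Implicit Types (w : T -> \bar R) (Q : set T) (E : set T).
Local Open Scope ereal_scope.

(* The topology of R^n is the one the library puts on row vectors. *)
Definition compact_Rn (K : set T) : Prop :=
  compact [set (\row_i coord x i : 'rV[R]_n)%R | x in K].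

Definition locally_integrable_Rn w : Prop :=
  measurable_fun [set: T] w /\
  forall K, compact_Rn K -> \int[lebesgue_Rn]_(x in K) `|w x| < +oo.

Definition weight w : Prop :=
  locally_integrable_Rn w /\ {ae lebesgue_Rn, forall x, 0 <= w x}.

Definition cubes : set (set T) :=
  [set Q | exists (a : T) (r : R), (0 < r)%R /\
    Q = [set x | forall i, (coord a i <= coord x i <= coord a i + r)%R]].

Definition average Q w : \bar R :=
  (\int[lebesgue_Rn]_(x in Q) w x) / lebesgue_Rn Q.

(* With [ln 0 = -oo], [exp +oo = +oo] and [0 * +oo = 0]. *)
Definition A_infty w : Prop :=
  weight w /\
  ereal_sup [set average Q w * expeR (- average Q (@lne R \o w)) | Q in cubes]
    < +oo.

Definition dist_pow E (b : R) : T -> \bar R := fun x => epowR (dist_set x E) b.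

Definition I_infty E : set R := [set b | A_infty (dist_pow E (- b)%R)].

Definition median_porous E : Prop :=
  E !=set0 /\ exists2 b : R, (0 < b)%R & I_infty E b.

Definition frac_int (alpha : R) (f : T -> \bar R) (x : T) : \bar R :=
  \int[lebesgue_Rn]_y (f y / (eucl_dist x y `^ (n%:R - alpha))%:E).

End weights.

(* Main.v *)
Require Import Defs.
From mathcomp Require Import all_boot all_order all_algebra.
From mathcomp Require Import all_classical all_reals all_analysis.
From mathcomp Require Import measurable_realfun ring lra.
Import Order.TTheory GRing.Theory Num.Theory.
Import numFieldNormedType.Exports.

Set Implicit Arguments.
Unset Strict Implicit.
Unset Printing Implicit Defensive.

Local Open Scope classical_set_scope.
Local Open Scope ring_scope.

(** The inequality is the one-weight theorem of Muckenhoupt and Wheeden for the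
    Riesz potential, with the weight [u = d^beta2] ([d] the distance to [E]) and
    its dual weight [sigma = d^(- beta1 / (p - 1)) = u^(- 1 / rho)], where
    [rho = q (p - 1) / p].  Writing [|f| = g sigma], the right-hand integral is
    [P = int g^p sigma], and the goal becomes
    [int (I_alpha (g sigma))^q u <= C P^(q / p)].

    The weights.  In the logarithmic form of the A_infinity condition the
    geometric means of [u] and of [sigma] are inverse to each other up to the
    power [rho], so multiplying the two hypotheses gives
    [avg u * (avg sigma)^rho <= K] on all cubes ([muckenhoupt_cubes]).  Together
    with Hoelder's inequality ([holder_dual_weights]) this says that a fixed
    Lebesgue fraction of a cube carries a fixed fraction of its [u]-mass; hence
    the [u]-mass of nested dyadic cubes decreases geometrically
    ([reverse_doubling]).  Median porosity makes [d] positive almost everywhere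
    ([lebesgue_dist_null]), since [d^(- b)] is then locally integrable for some
    [b > 0].

    The potential.  By the one-third trick ([shifted_cell]) the kernel is at most
    a constant times a sum over [2^n] dyadic grids of
    [l(Q)^(alpha - n) 1_Q(x) 1_Q(y)], so one grid at a time has to be treated.
    For a point [x] of a cell [Q] the term [l(Q)^(alpha - n) int_Q g sigma] has
    two bounds, as in Hedberg's inequality,
    [u(Q)^(1 / p - 1 / q) H(x)^(r' / p)] and [u(Q)^(- 1 / q) P^(1 / p)],
    with [r = 1 + rho] ([cell_potential_maximal], [cell_potential_norm]).  Because
    [u(Q)] is lacunary, the sum over the cells containing [x] is at most
    [C H(x)^(r' / q) P^(1 / p - 1 / q)] ([lacunary_sum]).

    The maximal function.  Here [H], suggested by Lerner's proof of Muckenhoupt's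
    maximal theorem, is the dyadic maximal function for the measure [u] of
    [(M_sigma g)^(p / r') / u], where [M_sigma] is the one for the measure
    [sigma].  Doob's inequality ([doob_maximal]) holds for both measures with
    constants that do not depend on them, and [u^(1 - r') = sigma], so
    [int H^r' u <= C int (M_sigma g)^p sigma <= C' P] ([cellmax_dual_bound]).
    Raising the pointwise bound to the power [q] and integrating gives the
    estimate for finitely many scales ([dyadic_potential_bound]), with a constant
    independent of their number; Fatou's lemma ([fatou_majorant]) gives all
    scales. *)

(** * Inequalities for real powers *)

Section real_inequalities.
Variable R : realType.
Implicit Types (a b c g m s t x y A B theta tau : R).

Lemma le_powR s x y : 0 <= s -> 0 <= x -> x <= y -> x `^ s <= y `^ s.
Proof.
move=> s0 x0 xy; apply: ge0_ler_powR => //; rewrite nnegrE//.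
exact: le_trans xy.
Qed.

Lemma powR_lt1 theta s : 0 < theta < 1 -> 0 < s -> theta `^ s < 1.
Proof.
move=> /andP[t0 t1] s0.
rewrite -[ltRHS](powRr0 theta) /powR gt_eqF// mul0r ltr_expR.
by rewrite nmulr_llt0// ln_lt0// t0 t1.
Qed.

Lemma conjugate_expK s : 1 < s -> s^-1 + (s / (s - 1))^-1 = 1.
Proof. by move=> s1; field; apply/andP; split; lra. Qed.

(** Young's inequality, cleared of the conjugate exponent [s / (s - 1)]. *)
Lemma young_powR s x b : 1 < s -> 0 <= x -> 0 <= b ->
  s * (x * b `^ (s - 1)) <= x `^ s + (s - 1) * b `^ s.
Proof.
move=> s1 x0 b0.
have s0 : 0 < s by lra.
have := conjugate_powR x0 (powR_ge0 b (s - 1)) s0 _ (conjugate_expK s1).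
have s'0 : 0 < s / (s - 1) by rewrite divr_gt0// subr_gt0.
move=> /(_ s'0).
rewrite -powRrM (_ : (s - 1) * _ = s); last by field; lra.
rewrite -(ler_pM2l s0) => /le_trans; apply; rewrite le_eqVlt.
by apply/orP; left; apply/eqP; field; apply/andP; split; lra.
Qed.

(** The running maximum changes only when it becomes equal to [x], and then the
    claim is Young's inequality.  Integrated, the terms in the maximum telescope. *)
Lemma doob_step s x b : 1 < s -> 0 <= x -> 0 <= b ->
  (s - 1) * Num.max b x `^ s + s * (x * b `^ (s - 1)) <=
  (s - 1) * b `^ s + s * (x * Num.max b x `^ (s - 1)).
Proof.
move=> s1 x0 b0; have [xb|bx] := leP x b; first exact: lexx.
have /= := young_powR s1 x0 b0.
rewrite mulr_powRB1//; last lra.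
lra.
Qed.

(** Either [g] is so small compared with [m] that half of [(s - 1) * m `^ s]
    dominates, or [m] is at most a multiple of [g].  The factor [(s - 1) / 2] is
    what can be absorbed into the left-hand side of [cellmax_powR_le_dual]. *)
Lemma doob_absorb s g m : 1 < s -> 0 <= g -> 0 <= m ->
  s * (g * m `^ (s - 1)) <=
  (s - 1) / 2 * m `^ s + s * (2 * s / (s - 1)) `^ (s - 1) * g `^ s.
Proof.
move=> s1 g0 m0; set c := 2 * s / (s - 1).
have c0 : 0 < c by rewrite divr_gt0 ?subr_gt0//; lra.
have s0 : 0 < s by lra.
have ms := mulr_powRB1 m0 s0.
have gs := mulr_powRB1 g0 s0.
have [mg|gm] := leP (c * g) m.
- apply: (@le_trans _ _ ((s - 1) / 2 * m `^ s)); last first.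
    by rewrite lerDl mulr_ge0 ?powR_ge0// mulr_ge0 ?powR_ge0//; lra.
  rewrite -ms [leLHS]mulrA [leRHS]mulrA ler_wpM2r ?powR_ge0//.
  rewrite (_ : s * g = (s - 1) / 2 * (c * g)); last by rewrite /c; field; lra.
  by rewrite ler_wpM2l//; lra.
- apply: (@le_trans _ _ (s * c `^ (s - 1) * g `^ s)); last first.
    by rewrite lerDr mulr_ge0 ?powR_ge0//; lra.
  rewrite -gs -mulrA ler_pM2l// mulrCA ler_wpM2l// -powRM//; last exact: ltW.
  by apply: le_powR => //; [lra|exact: ltW].
Qed.

(** Each term is at most [(1 - theta `^ s)^-1] times the drop of
    [Num.min (a j) tau `^ s] from [j] to [j.+1], so the sum telescopes. *)
Lemma lacunary_sum_small theta s tau (a : nat -> R) J :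
  0 < theta < 1 -> 0 < s -> 0 < tau -> (forall j, 0 < a j) ->
  (forall j, a j.+1 <= theta * a j) ->
  \sum_(j < J | a j <= tau) a j `^ s <= (1 - theta `^ s)^-1 * tau `^ s.
Proof.
move=> /andP[t0 t1] s0 tau0 a0 aS.
have ts1 : theta `^ s < 1 by rewrite powR_lt1// t0.
rewrite [leRHS]mulrC ler_pdivlMr ?subr_gt0// mulrC.
suff : (1 - theta `^ s) * \sum_(j < J | a j <= tau) a j `^ s +
    Num.min (a J) tau `^ s <= tau `^ s.
  by apply: le_trans; rewrite lerDl powR_ge0.
elim: J => [|J IH].
  rewrite big_ord0 mulr0 add0r; apply: le_powR; first exact: ltW.
    by rewrite le_min !ltW.
  by rewrite ge_min lexx orbT.
rewrite big_mkcond/= big_ord_recr/= -big_mkcond/=.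
apply: le_trans IH; rewrite mulrDr -addrA lerD2l.
have aJ : a J.+1 `^ s <= theta `^ s * a J `^ s.
  by rewrite -powRM ?(ltW t0) ?(ltW (a0 _))// le_powR// ltW.
case: ifPn => [aJt|].
  have -> : Num.min (a J.+1) tau = a J.+1.
    apply/min_idPl; rewrite (le_trans (aS J))// (le_trans _ aJt)//.
    by rewrite ger_pMl// ltW.
  have -> : Num.min (a J) tau = a J by exact/min_idPl.
  by rewrite mulrBl mul1r -lerBrDl opprB addrCA subrr addr0.
rewrite -ltNge => aJt; rewrite mulr0 add0r; apply: le_powR; first exact: ltW.
  by rewrite le_min !ltW.
by rewrite le_min !ge_min lexx (ltW aJt) !orbT.
Qed.

(** The mirror image of [lacunary_sum_small]: the terms are now dominated by the
    increments of [Num.max (a j) tau `^ (- t)]. *)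
Lemma lacunary_sum_large theta t tau (a : nat -> R) J :
  0 < theta < 1 -> 0 < t -> 0 < tau -> (forall j, 0 < a j) ->
  (forall j, a j.+1 <= theta * a j) ->
  \sum_(j < J | tau < a j) a j `^ (- t) <= (1 - theta `^ t)^-1 * tau `^ (- t).
Proof.
move=> /andP[t0 t1] s0 tau0 a0 aS.
have ts1 : theta `^ t < 1 by rewrite powR_lt1// t0.
have le_powRN x y : 0 < x -> x <= y -> y `^ (- t) <= x `^ (- t).
  move=> x0 xy; rewrite !powRN lef_pV2 ?posrE ?powR_gt0//.
    by rewrite le_powR// ltW.
  exact: lt_le_trans xy.
rewrite [leRHS]mulrC ler_pdivlMr ?subr_gt0// mulrC.
case: J => [|J]; first by rewrite big_ord0 mulr0 powR_ge0.
apply: (@le_trans _ _ (Num.max (a J) tau `^ (- t))); last first.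
  by rewrite le_powRN// le_max lexx orbT.
elim: J => [|J IH].
  rewrite big_mkcond big_ord_recr big_ord0/= add0r; case: ifPn => [ta|_]; last first.
    by rewrite mulr0 powR_ge0.
  rewrite (_ : Num.max (a 0%N) tau = a 0%N); last exact/max_idPl/ltW.
  by rewrite ger_pMl ?powR_gt0// gerBl powR_ge0.
rewrite big_mkcond/= big_ord_recr/= -big_mkcond/= mulrDr.
apply: le_trans (lerD IH (lexx _)) _.
case: ifPn => [ta|].
  have aJJ : a J.+1 <= a J.
    by rewrite (le_trans (aS J))// ger_pMl// ltW.
  have -> : Num.max (a J.+1) tau = a J.+1 by exact/max_idPl/ltW.
  have -> : Num.max (a J) tau = a J by apply/max_idPl; rewrite (le_trans _ aJJ)// ltW.
  rewrite mulrBl mul1r addrCA gerDl subr_le0.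
  rewrite -ler_pdivrMl ?powR_gt0// -powRN -powRM ?(ltW t0) ?(ltW (a0 _))//.
  by rewrite le_powRN.
rewrite -leNgt => aJt; rewrite mulr0 addr0 le_powRN//.
  by rewrite lt_max a0.
by rewrite ge_max !le_max lexx aJt !orbT.
Qed.

(** The two bounds on a term cross at [tau = (B / A) `^ (s + t)^-1].  On either
    side of [tau] the smaller one runs through a geometric sequence whose largest
    term is at most the common value at [tau], which is the right-hand side. *)
Lemma lacunary_sum theta s t A B (a : nat -> R) J :
  0 < theta < 1 -> 0 < s -> 0 < t -> 0 <= A -> 0 <= B ->
  (forall j, 0 < a j) -> (forall j, a j.+1 <= theta * a j) ->
  \sum_(j < J) Num.min (A * a j `^ s) (B * a j `^ (- t)) <=
  ((1 - theta `^ s)^-1 + (1 - theta `^ t)^-1) *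
    (A `^ (t / (s + t)) * B `^ (s / (s + t))).
Proof.
move=> th01 s0 t0; have st0 : 0 < s + t by rewrite addr_gt0.
rewrite le_eqVlt => /predU1P[<-|A0].
  move=> B0 a0 aS; rewrite powR0 ?gt_eqF ?divr_gt0// mul0r mulr0 big1// => j _.
  by rewrite mul0r; apply/min_idPl; rewrite mulr_ge0 ?powR_ge0.
rewrite le_eqVlt => /predU1P[<-|B0] a0 aS.
  rewrite (powR0 (x := s / (s + t))) ?gt_eqF ?divr_gt0// !mulr0 big1// => j _.
  by rewrite mul0r; apply/min_idPr; rewrite mulr_ge0 ?powR_ge0// ltW.
set tau := (B / A) `^ (s + t)^-1.
have tau0 : 0 < tau by rewrite powR_gt0// divr_gt0.
set K := A `^ _ * _.
have lntau : ln tau = (s + t)^-1 * (ln B - ln A).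
  by rewrite /tau ln_powR ln_div.
have lnK' : ln K = t / (s + t) * ln A + s / (s + t) * ln B.
  by rewrite /K lnM ?posrE ?powR_gt0// !ln_powR.
have K0 : 0 < K by rewrite mulr_gt0 ?powR_gt0.
(* Only the logarithms of [tau] and [K] matter from here on. *)
clearbody tau K.
have KA : A * tau `^ s = K.
  apply: ln_inj; rewrite ?posrE ?mulr_gt0 ?powR_gt0//.
  by rewrite lnM ?posrE ?powR_gt0// lnK' ln_powR lntau; field; rewrite gt_eqF.
have KB : B * tau `^ (- t) = K.
  apply: ln_inj; rewrite ?posrE ?mulr_gt0 ?powR_gt0//.
  by rewrite lnM ?posrE ?powR_gt0// lnK' ln_powR lntau; field; rewrite gt_eqF.
(* [A * a j `^ s] is the smaller bound for [a j <= tau], the other one above. *)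
rewrite (bigID (fun j : 'I_J => a j <= tau))/= mulrDl lerD//.
  rewrite -KA [leRHS]mulrCA.
  apply: (@le_trans _ _ (A * \sum_(j < J | a j <= tau) a j `^ s)).
    by rewrite mulr_sumr ler_sum// => j _; rewrite ge_min lexx.
  by rewrite ler_pM2l// lacunary_sum_small.
rewrite -KB [leRHS]mulrCA.
apply: (@le_trans _ _ (B * \sum_(j < J | tau < a j) a j `^ (- t))).
  under eq_bigl do rewrite -ltNge.
  by rewrite mulr_sumr ler_sum// => j _; rewrite ge_min lexx orbT.
by rewrite ler_pM2l// lacunary_sum_large.
Qed.

End real_inequalities.

(** * Integrals against a density *)

Section integrals.
Context d (T : measurableType d) (R : realType).
Variable mu : {measure set T -> \bar R}.

(** The integral of a nonnegative function is a supremum over the simple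
    functions below it, whether or not the function is measurable.  This is what
    bounds the integral of a potential by that of a measurable majorant. *)
Lemma le_integral_nonmeasurable (f g : T -> \bar R) :
  (forall x, 0 <= f x)%E -> (forall x, f x <= g x)%E ->
  (\int[mu]_x f x <= \int[mu]_x g x)%E.
Proof.
move=> f0 fg; have g0 x : (0 <= g x)%E by exact: le_trans (fg x).
rewrite !ge0_integralTE//; apply: le_ereal_sup => _ [h hf <-].
by exists h => // x; exact: le_trans (fg x).
Qed.

Lemma measurable_fun_powR (D : set T) (f : T -> R) s :
  measurable_fun D f -> measurable_fun D (fun x => f x `^ s).
Proof. by move=> mf; exact: (measurableT_comp (measurable_powR s)). Qed.

Lemma integralZ_real (D : set T) (c : R) (f : T -> R) : measurable D ->
  0 <= c -> measurable_fun D f -> (forall x, 0 <= f x) ->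
  (\int[mu]_(x in D) (c * f x)%:E = c%:E * \int[mu]_(x in D) (f x)%:E)%E.
Proof.
move=> mD c0 mf f0; under eq_integral do rewrite EFinM.
by rewrite ge0_integralZl//; [exact/measurable_EFinP|move=> x _; rewrite lee_fin].
Qed.

Lemma integralD_real (D : set T) (f g : T -> R) : measurable D ->
  measurable_fun D f -> measurable_fun D g ->
  (forall x, 0 <= f x) -> (forall x, 0 <= g x) ->
  (\int[mu]_(x in D) (f x + g x)%:E =
   \int[mu]_(x in D) (f x)%:E + \int[mu]_(x in D) (g x)%:E)%E.
Proof.
move=> mD mf mg f0 g0; under eq_integral do rewrite EFinD.
by rewrite ge0_integralD//; first [exact/measurable_EFinP|move=> x _; rewrite lee_fin].
Qed.

Lemma integral_ge0_real (D : set T) (f : T -> R) : (forall x, 0 <= f x) ->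
  (0 <= \int[mu]_(x in D) (f x)%:E)%E.
Proof. by move=> f0; apply: integral_ge0 => x _; rewrite lee_fin. Qed.

Lemma le_integral_real (D : set T) (f g : T -> R) : measurable D ->
  measurable_fun D f -> measurable_fun D g ->
  (forall x, D x -> 0 <= f x) -> (forall x, D x -> f x <= g x) ->
  (\int[mu]_(x in D) (f x)%:E <= \int[mu]_(x in D) (g x)%:E)%E.
Proof.
move=> mD mf mg f0 fg; apply: ge0_le_integral => //.
- exact/measurable_EFinP.
- exact/measurable_EFinP.
Qed.

(** Integrating Young's inequality [young_powR] with [b] a constant [t] bounds
    the mean of [g] linearly; the optimal [t] is that mean itself. *)
Lemma integral_powR_jensen (Z : set T) (v g : T -> R) (s : R) :
  measurable Z -> 1 < s ->
  measurable_fun setT v -> measurable_fun setT g ->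
  (forall x, 0 <= v x) -> (forall x, 0 <= g x) ->
  (\int[mu]_(x in Z) (v x)%:E < +oo)%E ->
  (\int[mu]_(x in Z) (g x `^ s * v x)%:E < +oo)%E ->
  (\int[mu]_(x in Z) (g x * v x)%:E < +oo)%E /\
  fine (\int[mu]_(x in Z) (g x * v x)%:E) `^ s <=
    fine (\int[mu]_(x in Z) (v x)%:E) `^ (s - 1) *
    fine (\int[mu]_(x in Z) (g x `^ s * v x)%:E).
Proof.
move=> mZ s1 mv mg v0 g0 Voo Poo.
have mv' : measurable_fun Z v by exact: measurable_funTS.
have mg' : measurable_fun Z g by exact: measurable_funTS.
have mgv : measurable_fun Z (fun x => g x * v x) by exact: measurable_funM.
have mgsv : measurable_fun Z (fun x => g x `^ s * v x).
  by apply: measurable_funM => //; exact: measurable_fun_powR.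
have V0 : (0 <= \int[mu]_(x in Z) (v x)%:E)%E.
  by apply: integral_ge0 => x _; rewrite lee_fin.
have P0 : (0 <= \int[mu]_(x in Z) (g x `^ s * v x)%:E)%E.
  by apply: integral_ge0 => x _; rewrite lee_fin mulr_ge0 ?powR_ge0.
have F0 : (0 <= \int[mu]_(x in Z) (g x * v x)%:E)%E.
  by apply: integral_ge0 => x _; rewrite lee_fin mulr_ge0.
have key t : 0 <= t -> ((s * t `^ (s - 1))%:E * \int[mu]_(x in Z) (g x * v x)%:E <=
    \int[mu]_(x in Z) (g x `^ s * v x)%:E +
    ((s - 1) * t `^ s)%:E * \int[mu]_(x in Z) (v x)%:E)%E.
  move=> t0; have s10 : 0 <= s - 1 by lra.
  have m1 c : measurable_fun Z (fun x => c * (g x * v x)) by exact: measurable_funM.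
  have m2 c : measurable_fun Z (fun x => c * v x) by exact: measurable_funM.
  rewrite -integralZ_real//; first last.
  - by move=> x; rewrite mulr_ge0.
  - by rewrite mulr_ge0 ?powR_ge0//; lra.
  rewrite -integralZ_real//; last by rewrite mulr_ge0 ?powR_ge0.
  rewrite -integralD_real//; first last.
  - by move=> x; rewrite !mulr_ge0 ?powR_ge0.
  - by move=> x; rewrite mulr_ge0 ?powR_ge0.
  apply: le_integral_real => //; first exact: measurable_funD.
    by move=> x _; rewrite !mulr_ge0 ?powR_ge0//; lra.
  move=> x _; have := ler_wpM2r (v0 x) (young_powR s1 (g0 x) t0).
  lra.
(* The bound with [t = 1] gives finiteness. *)
have Foo : (\int[mu]_(x in Z) (g x * v x)%:E < +oo)%E.
  have := key 1 ler01; rewrite !powR1 !mulr1 => h.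
  have : ((s%:E * \int[mu]_(x in Z) (g x * v x)%:E) < +oo)%E.
    apply: le_lt_trans h _; rewrite lte_add_pinfty// lte_mul_pinfty// lee_fin; lra.
  move: F0; case: (\int[mu]_(x in Z) (g x * v x)%:E)%E => [F| |]//.
    by move=> _ _; exact: ltry.
  by rewrite gt0_muley// lte_fin; lra.
split => //.
move: V0 P0 F0 Voo Poo Foo key.
case: (\int[mu]_(x in Z) (v x)%:E)%E => [V| |]//.
case: (\int[mu]_(x in Z) (g x `^ s * v x)%:E)%E => [P| |]//.
case: (\int[mu]_(x in Z) (g x * v x)%:E)%E => [F| |]//=.
rewrite !lee_fin le_eqVlt => /predU1P[<-|V0] P0 F0 _ _ _ key.
  (* If the mass [V] is zero, then [s * t `^ (s - 1) * F <= P] for all [t]. *)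
  suff -> : F = 0 by rewrite powR0 ?mulr_ge0 ?powR_ge0//; apply/eqP; lra.
  apply/eqP; rewrite -[_ == _]negbK; apply/negP => F0'.
  have {F0 F0'} F0 : 0 < F by rewrite lt_neqAle eq_sym F0' F0.
  have := key (((P + 1) / (s * F)) `^ (s - 1)^-1) (powR_ge0 _ _).
  rewrite -powRrM mulVf; last by apply/eqP; lra.
  have sF : 0 < s * F by rewrite mulr_gt0//; lra.
  rewrite powRr1; last by rewrite divr_ge0 ?ltW//; lra.
  rewrite -!EFinM -EFinD lee_fin !mulr0 addr0.
  rewrite (_ : s * _ * F = P + 1); first by lra.
  by field; rewrite !gt_eqF//; lra.
have s0 : 0 < s by lra.
(* The optimal [t] is the mean [F / V]. *)
have FV : 0 <= F / V by rewrite divr_ge0// ltW.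
have := key _ FV.
rewrite -!EFinM -EFinD lee_fin -[_ `^ s](mulr_powRB1 FV s0).
have Vs : 0 < V `^ (s - 1) by rewrite powR_gt0.
have VF : V * (F / V) = F by field; rewrite gt_eqF.
have XF : (V `^ (s - 1))^-1 * F `^ s = (F / V) `^ (s - 1) * F.
  rewrite -(mulr_powRB1 F0 s0) powRM ?invr_ge0 ?(ltW V0)//.
  rewrite -[V^-1]powR_inv1 ?(ltW V0)// powRAC powR_inv1 ?powR_ge0//; ring.
rewrite -ler_pdivrMl// XF; set X := _ `^ (s - 1); rewrite -/X.
rewrite (_ : (s - 1) * _ * V = (s - 1) * X * (V * (F / V))); last by ring.
rewrite VF; lra.
Qed.

(** Jensen's inequality for the function [1 / v] and the density [v], because
    [(1 / v) `^ (1 + r) * v = v `^ (- r) = u]. *)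
Lemma holder_dual_weights (Z : set T) (u v : T -> R) (r : R) :
  measurable Z -> 0 < r -> measurable_fun setT u ->
  (forall x, 0 < u x) -> (forall x, v x = u x `^ (- r^-1)) ->
  (mu Z < +oo)%E ->
  (\int[mu]_(x in Z) (u x)%:E < +oo)%E ->
  (\int[mu]_(x in Z) (v x)%:E < +oo)%E ->
  fine (mu Z) `^ (1 + r) <=
  fine (\int[mu]_(x in Z) (v x)%:E) `^ r * fine (\int[mu]_(x in Z) (u x)%:E).
Proof.
move=> mZ r0 mu_ u0 vE muZ uoo voo.
have v0 x : 0 < v x by rewrite vE powR_gt0.
have mv : measurable_fun setT v.
  by rewrite (_ : v = fun x => u x `^ (- r^-1)); [exact: measurable_fun_powR|exact/funext].
have gvE : (fun x => v x `^ (-1) * v x) = cst 1.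
  by apply/funext => x; rewrite powR_inv1 ?ltW// mulVf// gt_eqF.
have gsvE : (fun x => (v x `^ (-1)) `^ (1 + r) * v x) = u.
  apply/funext => x; rewrite -powRrM -{2}(powRr1 (ltW (v0 x))) -powRD; last first.
    by rewrite (gt_eqF (v0 x)) implybT.
  rewrite vE -powRrM (_ : _ * _ = 1) ?powRr1 ?ltW//.
  by field; rewrite gt_eqF.
have r1 : 1 < 1 + r by rewrite ltrDl.
have mg := measurable_fun_powR (-1) mv.
have jen f h : (fun x => v x `^ (-1) * v x) = f ->
    (fun x => (v x `^ (-1)) `^ (1 + r) * v x) = h ->
    (\int[mu]_(x in Z) (h x)%:E < +oo)%E ->
    fine (\int[mu]_(x in Z) (f x)%:E) `^ (1 + r) <=
    fine (\int[mu]_(x in Z) (v x)%:E) `^ (1 + r - 1) * fine (\int[mu]_(x in Z) (h x)%:E).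
  move=> <- <- hoo.
  by case: (integral_powR_jensen mZ r1 mv mg (fun x => ltW (v0 x))
    (fun x => powR_ge0 _ _) voo hoo).
have := jen _ _ gvE gsvE uoo.
have -> : (\int[mu]_(x in Z) (cst (1 : R) x)%:E = mu Z)%E.
  by rewrite -[RHS]mul1e -(integral_cst mu mZ 1%:E).
by rewrite [1 + r]addrC addrK.
Qed.

End integrals.

(** * Doob's inequality along a refining sequence of partitions *)

Definition doob_const (R : realType) (s : R) : R :=
  2 / (s - 1) * (s * (2 * s / (s - 1)) `^ (s - 1)).

Lemma doob_const_ge0 (R : realType) (s : R) : 1 < s -> 0 <= doob_const s.
Proof.
move=> s1; rewrite /doob_const mulr_ge0// ?divr_ge0 ?subr_ge0 ?(ltW s1)//.
by rewrite mulr_ge0 ?powR_ge0// (le_trans ler01)// ltW.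
Qed.

Section cells.
Context d (T : measurableType d) (R : realType).
Variables (mu : {measure set T -> \bar R}) (idx : nat -> T -> nat).

(** A sequence of countable partitions is encoded by index functions into [nat]:
    the cell of [x] at level [j] is the set of points with the index of [x].  The
    measurability of the partition is then that of [idx j]. *)
Definition cell j x : set T := [set y | idx j y = idx j x].

Definition cellint (f : T -> R) j x : R :=
  fine (\int[mu]_(y in cell j x) (f y)%:E).

Definition cellavg (v g : T -> R) j x : R :=
  cellint (fun y => g y * v y) j x / cellint v j x.

Fixpoint cellmax (v g : T -> R) k x : R :=
  if k is k'.+1 then Num.max (cellmax v g k' x) (cellavg v g k x)
  else cellavg v g 0 x.

Definition adapted j (F : T -> R) := forall x y, idx j x = idx j y -> F x = F y.

Definition cell_weight (v : T -> R) :=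
  [/\ measurable_fun setT v, forall x, 0 <= v x &
      forall j x, (0 < \int[mu]_(y in cell j x) (v y)%:E < +oo)%E].

Lemma cell_eq j x y : idx j x = idx j y -> cell j x = cell j y.
Proof. by move=> e; rewrite /cell e. Qed.

Lemma cellint_adapted f j : adapted j (cellint f j).
Proof. by move=> x y /cell_eq e; rewrite /cellint e. Qed.

Lemma cellavg_adapted v g j : adapted j (cellavg v g j).
Proof.
by move=> x y e; rewrite /cellavg (cellint_adapted _ e) (cellint_adapted v e).
Qed.

Lemma cellint_ge0 f j x : (forall x, 0 <= f x) -> 0 <= cellint f j x.
Proof. by move=> f0; rewrite fine_ge0// integral_ge0_real. Qed.

Lemma cellavg_ge0 v g j x :
  (forall x, 0 <= v x) -> (forall x, 0 <= g x) -> 0 <= cellavg v g j x.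
Proof.
by move=> v0 g0; rewrite divr_ge0// cellint_ge0// => y; exact: mulr_ge0.
Qed.

Lemma cellmax_ge0 v g k x :
  (forall x, 0 <= v x) -> (forall x, 0 <= g x) -> 0 <= cellmax v g k x.
Proof.
move=> v0 g0; elim: k => /= [|k IH]; first exact: cellavg_ge0.
by rewrite le_max IH.
Qed.

Lemma cellavg_le_max v g j k x : (j <= k)%N -> cellavg v g j x <= cellmax v g k x.
Proof.
elim: k => [|k IH]; first by rewrite leqn0 => /eqP ->.
by rewrite leq_eqVlt => /predU1P[->|/IH h] /=; rewrite le_max ?lexx ?orbT// h.
Qed.

Hypothesis midx : forall j, measurable_fun setT (idx j).
Hypothesis refine : forall j x y, idx j.+1 x = idx j.+1 y -> idx j x = idx j y.

Lemma cell_sub j x : cell j.+1 x `<=` cell j x.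
Proof. by move=> y /refine. Qed.

Lemma adaptedS j F : adapted j F -> adapted j.+1 F.
Proof. by move=> aF x y /refine /aF. Qed.

Lemma cellmax_adapted v g k : adapted k (cellmax v g k).
Proof.
elim: k => [|k IH] x y e /=; first exact: cellavg_adapted.
by rewrite (adaptedS IH e) (cellavg_adapted v g e).
Qed.

Lemma measurable_cellidx j m : measurable (idx j @^-1` [set m]).
Proof. by rewrite -[X in measurable X]setTI; exact: midx. Qed.

Lemma measurable_cell j x : measurable (cell j x).
Proof. exact: measurable_cellidx. Qed.

(** An adapted function factors through the index, and every set of indices is
    measurable. *)
Lemma measurable_adapted j F : adapted j F -> measurable_fun setT F.
Proof.
move=> aF _ B mB; rewrite setTI.
rewrite (_ : F @^-1` B = idx j @^-1` (idx j @` (F @^-1` B))).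
  by rewrite -[X in measurable X]setTI; exact: midx.
apply/seteqP; split => [x Bx|x [y By yx]]; first by exists x.
by rewrite /preimage/= -(aF _ _ yx).
Qed.

Lemma integral_cells (f : T -> \bar R) j :
  measurable_fun setT f -> (forall x, 0 <= f x)%E ->
  (\int[mu]_x f x = \sum_(m <oo) \int[mu]_(x in idx j @^-1` [set m]) f x)%E.
Proof.
move=> mf f0; rewrite -ge0_integral_bigcup//.
- by congr (integral _ _ _); apply/seteqP; split => // x _; exists (idx j x).
- exact: measurable_cellidx.
- exact: measurable_funTS.
- by apply/trivIsetP => /= a b _ _ ab; apply/seteqP; split => // x [/= -> /eqP];
    rewrite (negbTE ab).
Qed.

Lemma le_integral_cells (f g : T -> \bar R) j :
  measurable_fun setT f -> measurable_fun setT g ->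
  (forall x, 0 <= f x)%E -> (forall x, 0 <= g x)%E ->
  (forall x, \int[mu]_(y in cell j x) f y <= \int[mu]_(y in cell j x) g y)%E ->
  (\int[mu]_x f x <= \int[mu]_x g x)%E.
Proof.
move=> mf mg f0 g0 fg; rewrite (integral_cells j mf f0) (integral_cells j mg g0).
apply: lee_nneseries => [m _ _|m _]; first exact: integral_ge0.
have [[x xm]|e] := pselect (exists x, idx j x = m).
  by have := fg x; rewrite /cell xm.
have -> : idx j @^-1` [set m] = set0.
  by apply/seteqP; split => // x /= xm; case: e; exists x.
by rewrite !integral_set0.
Qed.

Lemma integral_adapted_cell (h f : T -> R) j x : adapted j h ->
  (forall x, 0 <= h x) -> (forall x, 0 <= f x) -> measurable_fun setT f ->
  (\int[mu]_(y in cell j x) (h y * f y)%:E =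
   (h x)%:E * \int[mu]_(y in cell j x) (f y)%:E)%E.
Proof.
move=> ah h0 f0 mf; rewrite -integralZ_real//.
- by apply: eq_integral => y; rewrite inE => /= /ah ->.
- exact: measurable_cell.
- exact: measurable_funTS.
Qed.

Section weight.
Variable v : T -> R.
Hypothesis wv : cell_weight v.

Let mv : measurable_fun setT v. Proof. by case: wv. Qed.
Let v0 x : 0 <= v x. Proof. by case: wv. Qed.

Lemma cellint_gt0 j x : 0 < cellint v j x.
Proof. by case: wv => _ _ /(_ j x) ?; exact: fine_gt0. Qed.

Lemma cellintE j x : ((cellint v j x)%:E = \int[mu]_(y in cell j x) (v y)%:E)%E.
Proof.
case: wv => _ _ /(_ j x)/andP[h0 h1]; rewrite /cellint fineK//.
by rewrite ge0_fin_numE// ltW.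
Qed.

(** The averages are the conditional expectation of [g] for the measure with
    density [v]: on a cell both [h] and the average are constant. *)
Lemma cell_tower (h g : T -> R) j : adapted j h ->
  (forall x, 0 <= h x) -> (forall x, 0 <= g x) -> measurable_fun setT g ->
  (forall x, \int[mu]_(y in cell j x) (g y * v y)%:E < +oo)%E ->
  (\int[mu]_x (h x * cellavg v g j x * v x)%:E =
   \int[mu]_x (h x * (g x * v x))%:E)%E.
Proof.
move=> ah h0 g0 mg goo.
have mh := measurable_adapted ah.
have ma := measurable_adapted (@cellavg_adapted v g j).
have mgv : measurable_fun setT (fun x => g x * v x) by exact: measurable_funM.
have a0 x : 0 <= cellavg v g j x by exact: cellavg_ge0.
have aha : adapted j (fun x => h x * cellavg v g j x).
  by move=> x y e; rewrite (ah _ _ e) (cellavg_adapted v g e).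
have E x : (\int[mu]_(y in cell j x) (h y * cellavg v g j y * v y)%:E =
            \int[mu]_(y in cell j x) (h y * (g y * v y))%:E)%E.
  rewrite (integral_adapted_cell x aha)//; last by move=> y; exact: mulr_ge0.
  rewrite (integral_adapted_cell x ah)//; last by move=> y; exact: mulr_ge0.
  rewrite -cellintE -EFinM -mulrA divfK ?gt_eqF ?cellint_gt0// EFinM.
  by rewrite /cellint fineK// ge0_fin_numE ?goo// integral_ge0_real// => y; exact: mulr_ge0.
have m1 : measurable_fun setT (fun x => (h x * cellavg v g j x * v x)%:E).
  by apply/measurable_EFinP; apply: measurable_funM => //; exact: measurable_funM.
have m2 : measurable_fun setT (fun x => (h x * (g x * v x))%:E).
  by apply/measurable_EFinP; exact: measurable_funM.
have p1 x : (0 <= (h x * cellavg v g j x * v x)%:E)%E.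
  by rewrite lee_fin; apply: mulr_ge0 => //; exact: mulr_ge0.
have p2 x : (0 <= (h x * (g x * v x))%:E)%E by rewrite lee_fin !mulr_ge0.
apply/eqP; rewrite eq_le; apply/andP; split.
  by apply: (le_integral_cells (j := j) m1 m2 p1 p2) => x; rewrite E.
by apply: (le_integral_cells (j := j) m2 m1 p2 p1) => x; rewrite E.
Qed.

Variables (s : R) (g : T -> R).
Hypotheses (s1 : 1 < s) (mg : measurable_fun setT g) (g0 : forall x, 0 <= g x).
Hypothesis goo : (\int[mu]_x (g x `^ s * v x)%:E < +oo)%E.

Let mgs : measurable_fun setT (fun x => g x `^ s * v x).
Proof. by apply: measurable_funM => //; exact: measurable_fun_powR. Qed.

Let gs0 x : 0 <= g x `^ s * v x.
Proof. by rewrite mulr_ge0 ?powR_ge0. Qed.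

Lemma cell_powR_lty j x : (\int[mu]_(y in cell j x) (g y `^ s * v y)%:E < +oo)%E.
Proof.
apply: le_lt_trans goo; apply: ge0_subset_integral => //.
- exact: measurable_cell.
- exact/measurable_EFinP.
- by move=> y _; rewrite lee_fin.
Qed.

Lemma cell_jensen j x :
  (\int[mu]_(y in cell j x) (g y * v y)%:E < +oo)%E /\
  cellint (fun y => g y * v y) j x `^ s <=
    cellint v j x `^ (s - 1) * cellint (fun y => g y `^ s * v y) j x.
Proof.
apply: integral_powR_jensen => //; first exact: measurable_cell.
  by case: wv => _ _ /(_ j x)/andP[].
exact: cell_powR_lty.
Qed.

Lemma cellavg_powR_le j :
  (\int[mu]_x (cellavg v g j x `^ s * v x)%:E <= \int[mu]_x (g x `^ s * v x)%:E)%E.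
Proof.
have ap : adapted j (fun x => cellavg v g j x `^ s).
  by move=> x y e; rewrite (cellavg_adapted v g e).
have mp := measurable_adapted ap.
apply: (@le_integral_cells _ _ j).
- by apply/measurable_EFinP; exact: measurable_funM.
- exact/measurable_EFinP.
- by move=> x; rewrite lee_fin mulr_ge0 ?powR_ge0.
- by move=> x; rewrite lee_fin.
move=> x; rewrite (integral_adapted_cell x ap)//; last by move=> y; exact: powR_ge0.
rewrite -cellintE -EFinM.
rewrite -[leRHS]fineK; last first.
  by rewrite ge0_fin_numE ?cell_powR_lty ?integral_ge0_real.
rewrite lee_fin -/(cellint _ j x).
have [_] := cell_jensen j x.
have V0 := cellint_gt0 j x.
rewrite -ler_pdivrMl ?powR_gt0//; apply: le_trans.
rewrite /cellavg powRM ?invr_ge0 ?(ltW V0)//; last first.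
  by rewrite cellint_ge0// => y; exact: mulr_ge0.
rewrite -[(cellint v j x)^-1]powR_inv1 ?(ltW V0)// powRAC powR_inv1 ?powR_ge0//.
rewrite -[(cellint v j x) `^ s](mulr_powRB1 (ltW V0)); last exact: lt_trans ltr01 s1.
have := powR_gt0 (s - 1) V0; move: V0; move: (cellint v j x) (_ `^ (s - 1)) (_ `^ s).
move=> V W F V0 W0; rewrite le_eqVlt; apply/orP; left; apply/eqP; field.
by rewrite !gt_eqF.
Qed.

Lemma measurable_cellmax_powR k r : measurable_fun setT (fun x => cellmax v g k x `^ r).
Proof. exact/measurable_fun_powR/(measurable_adapted (@cellmax_adapted v g k)). Qed.

(** A maximum of nonnegative numbers is at most their sum.  The finiteness is
    what allows terms to be cancelled in the proof of Doob's inequality. *)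
Lemma cellmax_powR_lty k : (\int[mu]_x (cellmax v g k x `^ s * v x)%:E < +oo)%E.
Proof.
elim: k => [|k IH]; first exact: le_lt_trans (cellavg_powR_le 0) goo.
have mm := measurable_cellmax_powR k s.
have ma : measurable_fun setT (fun x => cellavg v g k.+1 x `^ s).
  exact/measurable_fun_powR/(measurable_adapted (@cellavg_adapted v g k.+1)).
have mm' := measurable_cellmax_powR k.+1 s.
apply: (@le_lt_trans _ _ (\int[mu]_x (cellmax v g k x `^ s * v x +
    cellavg v g k.+1 x `^ s * v x)%:E)%E).
  apply: le_integral_real => //.
  - exact: measurable_funM.
  - by apply: measurable_funD; exact: measurable_funM.
  - by move=> x _; rewrite mulr_ge0 ?powR_ge0.
  move=> x _ /=; rewrite -mulrDl ler_wpM2r//.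
  have [_|_] := leP (cellmax v g k x) (cellavg v g k.+1 x).
    by rewrite lerDr; exact: powR_ge0.
  by rewrite lerDl; exact: powR_ge0.
rewrite integralD_real//.
- apply: lte_add_pinfty; first exact: IH.
  exact: le_lt_trans (cellavg_powR_le k.+1) goo.
- exact: measurable_funM.
- exact: measurable_funM.
- by move=> x; rewrite mulr_ge0 ?powR_ge0.
- by move=> x; rewrite mulr_ge0 ?powR_ge0.
Qed.

Lemma cellmax_dual_le k :
  (s%:E * \int[mu]_x (cellmax v g k x `^ (s - 1) * (g x * v x))%:E <=
   ((s - 1) / 2)%:E * \int[mu]_x (cellmax v g k x `^ s * v x)%:E +
   (s * (2 * s / (s - 1)) `^ (s - 1))%:E * \int[mu]_x (g x `^ s * v x)%:E)%E.
Proof.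
have s0 : 0 <= s by exact: ltW (lt_trans ltr01 s1).
have m0 x := cellmax_ge0 k x v0 g0.
have mm := measurable_cellmax_powR k s.
have mm1 := measurable_cellmax_powR k (s - 1).
have mgv : measurable_fun setT (fun x => g x * v x) by exact: measurable_funM.
have mmv : measurable_fun setT (fun x => cellmax v g k x `^ s * v x).
  exact: measurable_funM.
have mmgv : measurable_fun setT (fun x => cellmax v g k x `^ (s - 1) * (g x * v x)).
  exact: measurable_funM.
have c0 : 0 <= s * (2 * s / (s - 1)) `^ (s - 1) by rewrite mulr_ge0 ?powR_ge0.
have d0 : 0 <= (s - 1) / 2 by move: s1; lra.
have q0 x : 0 <= cellmax v g k x `^ s * v x by rewrite mulr_ge0 ?powR_ge0.
have q1 x : 0 <= cellmax v g k x `^ (s - 1) * (g x * v x).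
  by rewrite mulr_ge0 ?powR_ge0// mulr_ge0.
rewrite -(integralZ_real mu measurableT s0 mmgv q1).
rewrite -(integralZ_real mu measurableT d0 mmv q0).
rewrite -(integralZ_real mu measurableT c0 mgs gs0).
rewrite -integralD_real//; first last.
- by move=> x; apply: mulr_ge0.
- by move=> x; apply: mulr_ge0.
- exact: measurable_funM.
- exact: measurable_funM.
apply: le_integral_real => //.
- exact: measurable_funM.
- by apply: measurable_funD; exact: measurable_funM.
- by move=> x _; apply: mulr_ge0.
move=> x _; have := ler_wpM2r (v0 x) (doob_absorb s1 (g0 x) (m0 x)); lra.
Qed.

Lemma cellmax_dual_lty k :
  (\int[mu]_x (cellmax v g k x `^ (s - 1) * (g x * v x))%:E < +oo)%E.
Proof.
have s0 : 0 < s by exact: lt_trans ltr01 s1.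
have q0 x : 0 <= cellmax v g k x `^ s * v x by rewrite mulr_ge0 ?powR_ge0.
have gP := integral_ge0_real mu setT gs0.
have gM := integral_ge0_real mu setT q0.
move: (cellmax_powR_lty k) goo gP gM (cellmax_dual_le k).
move: (\int[mu]_x (cellmax v g k x `^ s * v x)%:E)%E
  (\int[mu]_x (g x `^ s * v x)%:E)%E
  (\int[mu]_x (cellmax v g k x `^ (s - 1) * (g x * v x))%:E)%E.
move=> [A| |] [B| |]// [D| |]// _ _ _ _; first by rewrite ltry.
by rewrite gt0_muley ?lte_fin.
Qed.

(** Integrating [doob_step] for the maximum up to level [k] and the average at
    level [k.+1].  Both maxima are adapted to level [k.+1], so [cell_tower] turns
    the average into [g], and the dual integral at level [k] cancels. *)
Lemma cellmax_powR_le_dual k :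
  ((s - 1)%:E * \int[mu]_x (cellmax v g k x `^ s * v x)%:E <=
   s%:E * \int[mu]_x (cellmax v g k x `^ (s - 1) * (g x * v x))%:E)%E.
Proof.
have s0 : 0 < s by exact: lt_trans ltr01 s1.
have sm1 : 0 <= s - 1 by rewrite subr_ge0 ltW.
have a0 j x : 0 <= cellavg v g j x by exact: cellavg_ge0.
have goo' j x : (\int[mu]_(y in cell j x) (g y * v y)%:E < +oo)%E.
  by case: (cell_jensen j x).
have mgv : measurable_fun setT (fun x => g x * v x) by exact: measurable_funM.
have maa j : measurable_fun setT (cellavg v g j).
  exact: measurable_adapted (@cellavg_adapted v g j).
have gv0 x : 0 <= g x * v x by exact: mulr_ge0.
elim: k => [|k IH].
  have := @cell_tower (fun x => cellavg v g 0 x `^ (s - 1)) g 0 _ _ g0 mg (goo' 0%N).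
  rewrite /= => <-; first last.
  - by move=> x; exact: powR_ge0.
  - by move=> x y e; rewrite (cellavg_adapted v g e).
  under [in leRHS]eq_integral => x _ do rewrite [_ * cellavg _ _ _ _]mulrC mulr_powRB1//.
  apply: lee_wpmul2r; last by rewrite lee_fin; lra.
  by apply: integral_ge0_real => x; rewrite mulr_ge0 ?powR_ge0.
pose M := cellmax v g k; pose N := cellmax v g k.+1; pose X := cellavg v g k.+1.
have M0 x : 0 <= M x by exact: cellmax_ge0.
have X0 x : 0 <= X x by exact: a0.
have mX : measurable_fun setT X by exact: maa.
have mM r : measurable_fun setT (fun x => M x `^ r) by exact: measurable_cellmax_powR.
have mN r : measurable_fun setT (fun x => N x `^ r) by exact: measurable_cellmax_powR.
have towM := @cell_tower (fun x => M x `^ (s - 1)) g k.+1 _ _ g0 mg (goo' k.+1).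
have towN := @cell_tower (fun x => N x `^ (s - 1)) g k.+1 _ _ g0 mg (goo' k.+1).
have {}towM : (\int[mu]_x (M x `^ (s - 1) * X x * v x)%:E =
   \int[mu]_x (M x `^ (s - 1) * (g x * v x))%:E)%E.
  apply: towM => [x y e|x]; last exact: powR_ge0.
  by rewrite /M (cellmax_adapted v g (refine e)).
have {}towN : (\int[mu]_x (N x `^ (s - 1) * X x * v x)%:E =
   \int[mu]_x (N x `^ (s - 1) * (g x * v x))%:E)%E.
  apply: towN => [x y e|x]; last exact: powR_ge0.
  by rewrite /N (cellmax_adapted v g e).
have NE x : N x = Num.max (M x) (X x) by [].
move: IH (cellmax_dual_lty k); rewrite -/M -/N => IH Doo.
clearbody M N X.
have step : ((s - 1)%:E * \int[mu]_x (N x `^ s * v x)%:E +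
    s%:E * \int[mu]_x (M x `^ (s - 1) * (g x * v x))%:E <=
    (s - 1)%:E * \int[mu]_x (M x `^ s * v x)%:E +
    s%:E * \int[mu]_x (N x `^ (s - 1) * (g x * v x))%:E)%E.
  rewrite -towM -towN.
  have p1 (Y : T -> R) r x : 0 <= Y x `^ r * v x by rewrite mulr_ge0 ?powR_ge0.
  have p2 Y r x : 0 <= Y x `^ r * X x * v x.
    by rewrite mulr_ge0// mulr_ge0// powR_ge0.
  have q1 r : measurable_fun setT (fun x => M x `^ r * v x) by exact: measurable_funM.
  have q2 r : measurable_fun setT (fun x => N x `^ r * v x) by exact: measurable_funM.
  have q3 r : measurable_fun setT (fun x => M x `^ r * X x * v x).
    by apply: measurable_funM => //; exact: measurable_funM.
  have q4 r : measurable_fun setT (fun x => N x `^ r * X x * v x).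
    by apply: measurable_funM => //; exact: measurable_funM.
  have s0' := ltW s0.
  have r1 r : measurable_fun setT (fun x => (s - 1) * (M x `^ r * v x)).
    exact: measurable_funM.
  have r2 r : measurable_fun setT (fun x => (s - 1) * (N x `^ r * v x)).
    exact: measurable_funM.
  have r3 r : measurable_fun setT (fun x => s * (M x `^ r * X x * v x)).
    exact: measurable_funM.
  have r4 r : measurable_fun setT (fun x => s * (N x `^ r * X x * v x)).
    exact: measurable_funM.
  have t1 Y r x : 0 <= (s - 1) * (Y x `^ r * v x) by apply: mulr_ge0.
  have t2 Y r x : 0 <= s * (Y x `^ r * X x * v x) by apply: mulr_ge0.
  have sumE (Y Z : T -> R) : measurable_fun setT (fun x => Y x `^ s * v x) ->
      measurable_fun setT (fun x => Z x `^ (s - 1) * X x * v x) ->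
      ((s - 1)%:E * \int[mu]_x (Y x `^ s * v x)%:E +
        s%:E * \int[mu]_x (Z x `^ (s - 1) * X x * v x)%:E =
      \int[mu]_x ((s - 1) * (Y x `^ s * v x) +
        s * (Z x `^ (s - 1) * X x * v x))%:E)%E.
    move=> mY mZ; rewrite integralD_real//; [|exact: measurable_funM..].
    by rewrite integralZ_real// integralZ_real.
  rewrite [leLHS](sumE N M (q2 _) (q3 _)).
  rewrite [leRHS](sumE M N (q1 _) (q4 _)).
  apply: le_integral_real => //; do ?[exact: measurable_funD].
    by move=> x _; apply: addr_ge0.
  move=> x _; have := ler_wpM2r (v0 x) (doob_step s1 (X0 x) (M0 x)).
  rewrite -NE; lra.
move: step IH Doo.
have : (0 <= \int[mu]_x (M x `^ (s - 1) * (g x * v x))%:E)%E.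
  by apply: integral_ge0_real => x; rewrite mulr_ge0 ?powR_ge0.
move: (\int[mu]_x (M x `^ (s - 1) * (g x * v x))%:E)%E => [D| |]// _ h1 h2 _.
have := le_trans h1 (leeD2r _ h2); rewrite addeC.
by rewrite -EFinM leeD2lE.
Qed.

(** Doob's inequality, with a constant independent of the number of levels and
    of the measure. *)
Lemma doob_maximal k :
  (\int[mu]_x (cellmax v g k x `^ s * v x)%:E <=
   (doob_const s)%:E * \int[mu]_x (g x `^ s * v x)%:E)%E.
Proof.
have q0 x : 0 <= cellmax v g k x `^ s * v x by rewrite mulr_ge0 ?powR_ge0.
have gP := integral_ge0_real mu setT gs0.
have gM := integral_ge0_real mu setT q0.
have := le_trans (cellmax_powR_le_dual k) (cellmax_dual_le k).
move: (cellmax_powR_lty k) goo gP gM.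
move: (\int[mu]_x (cellmax v g k x `^ s * v x)%:E)%E
  (\int[mu]_x (g x `^ s * v x)%:E)%E => [A| |] [B| |]// _ _ _ _.
rewrite -!EFinM -EFinD !lee_fin /doob_const => h.
have s2 : 0 < (s - 1) / 2 by move: s1; lra.
rewrite -(ler_pM2l s2).
rewrite (_ : (s - 1) / 2 * (_ * B) = s * (2 * s / (s - 1)) `^ (s - 1) * B).
  by move: h; set W := _ * B; lra.
by field; move: s1; lra.
Qed.


End weight.
End cells.

(** * Hedberg's inequality and its exponents *)

Section exponents.
Variable R : realType.
Variables (gam p K : R).
Hypotheses (gam0 : 0 < gam) (p1 : 1 < p) (gp : gam * p < 1) (K1 : 1 <= K).

(** With [gam = alpha / n] this is [q = n p / (n - alpha p)]. *)
Definition sobolev_exp : R := p / (1 - gam * p).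
(** [q (p - 1) / p]: the pair [u], [u `^ (- dual_exp^-1)] are dual weights of the
    Muckenhoupt class of index [r = 1 + dual_exp]. *)
Definition dual_exp : R := (p - 1) / (1 - gam * p).
(** The exponent conjugate to [r = 1 + dual_exp]. *)
Definition muck_conj : R := p * (1 - gam) / (p - 1).

Let p0 : 0 < p. Proof. exact: lt_trans ltr01 p1. Qed.
Let pm1 : 0 < p - 1. Proof. by rewrite subr_gt0. Qed.
Let gpm : 0 < 1 - gam * p. Proof. by rewrite subr_gt0. Qed.
Let K0 : 0 < K. Proof. exact: lt_le_trans ltr01 K1. Qed.

Lemma gam_lt1 : gam < 1.
Proof. by apply: lt_trans gp; rewrite -[ltLHS]mulr1 ltr_pM2l. Qed.

Let g1 : 0 < 1 - gam. Proof. by rewrite subr_gt0 gam_lt1. Qed.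

Lemma sobolev_exp_gt0 : 0 < sobolev_exp. Proof. exact: divr_gt0. Qed.
Lemma dual_exp_gt0 : 0 < dual_exp. Proof. exact: divr_gt0. Qed.
Lemma muck_conj_gt1 : 1 < muck_conj.
Proof. by rewrite ltr_pdivlMr// mul1r mulrBr mulr1 ltrD2l ltrN2 mulrC. Qed.

(** For a cell of measure [L] with [U], [S] the masses of the two weights, [A]
    the average of [g] and [H] the value of the maximal function.  In logarithms
    the claim is [dual_exp^-1] times the first hypothesis plus [muck_conj / p]
    times the second one. *)
Lemma potential_le_maximal (L U S A H : R) :
  0 < L -> 0 < U -> 0 < S -> 0 <= A -> 0 <= H ->
  U * S `^ dual_exp <= K * L `^ (1 + dual_exp) ->
  A `^ (p / muck_conj) * L <= H * U ->
  L `^ (gam - 1) * (A * S) <= K `^ dual_exp^-1 * H `^ (muck_conj / p) * U `^ gam.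
Proof.
move=> L0 U0 S0 A0 H0 h1 h2.
move: A0; rewrite le_eqVlt => /predU1P[A0|A0].
  by rewrite -A0 mul0r mulr0 !mulr_ge0 ?powR_ge0.
have {}H0 : 0 < H.
  rewrite -(pmulr_lgt0 _ U0); apply: lt_le_trans h2.
  by rewrite mulr_gt0// powR_gt0.
rewrite -ler_ln ?posrE ?mulr_gt0 ?powR_gt0// in h1.
rewrite -ler_ln ?posrE ?mulr_gt0 ?powR_gt0// in h2.
rewrite -ler_ln ?posrE ?mulr_gt0 ?powR_gt0//.
rewrite !lnM ?posrE ?mulr_gt0 ?powR_gt0// !ln_powR in h1 *.
rewrite !lnM ?posrE ?mulr_gt0 ?powR_gt0// !ln_powR in h2.
have rp0 : 0 < muck_conj / p by rewrite divr_gt0// (lt_trans ltr01)// muck_conj_gt1.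
have ri0 : 0 < dual_exp^-1 by rewrite invr_gt0 dual_exp_gt0.
have k1 := ler_wpM2l (ltW ri0) h1; have k2 := ler_wpM2l (ltW rp0) h2.
have := lerD k1 k2.
move: (ln L) (ln U) (ln S) (ln A) (ln H) (ln K) => l u s a h k.
rewrite -subr_ge0 -[in X in _ -> X]subr_ge0; congr (0 <= _).
by rewrite /muck_conj /dual_exp; field; rewrite !gt_eqF.
Qed.

(** In logarithms, [sobolev_exp^-1] times the first hypothesis plus [p^-1] times
    the second one. *)
Lemma potential_le_norm (L U S F P : R) :
  0 < L -> 0 < U -> 0 < S -> 0 <= F -> 0 <= P ->
  U * S `^ dual_exp <= K * L `^ (1 + dual_exp) ->
  F `^ p <= S `^ (p - 1) * P ->
  L `^ (gam - 1) * F <= K `^ sobolev_exp^-1 * P `^ p^-1 * U `^ (- sobolev_exp^-1).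
Proof.
move=> L0 U0 S0 F0 P0 h1 h2.
move: F0; rewrite le_eqVlt => /predU1P[F0|F0].
  by rewrite -F0 mulr0 !mulr_ge0 ?powR_ge0.
have {}P0 : 0 < P.
  rewrite -(pmulr_rgt0 _ (powR_gt0 (p - 1) S0)); apply: lt_le_trans h2.
  by rewrite powR_gt0.
rewrite -ler_ln ?posrE ?mulr_gt0 ?powR_gt0// in h1.
rewrite -ler_ln ?posrE ?mulr_gt0 ?powR_gt0// in h2.
rewrite -ler_ln ?posrE ?mulr_gt0 ?powR_gt0//.
rewrite !lnM ?posrE ?mulr_gt0 ?powR_gt0// !ln_powR in h1 *.
rewrite !lnM ?posrE ?mulr_gt0 ?powR_gt0// !ln_powR in h2.
have sp0 : 0 < sobolev_exp^-1 by rewrite invr_gt0 sobolev_exp_gt0.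
have pi0 : 0 < p^-1 by rewrite invr_gt0.
have k1 := ler_wpM2l (ltW sp0) h1; have k2 := ler_wpM2l (ltW pi0) h2.
have := lerD k1 k2.
move: (ln L) (ln U) (ln S) (ln F) (ln P) (ln K) => l u s a h k.
rewrite -subr_ge0 -[in X in _ -> X]subr_ge0; congr (0 <= _).
by rewrite /sobolev_exp /dual_exp; field; rewrite !gt_eqF.
Qed.

(** Half of a cell carries at least the fraction [2 `^ (- (1 + dual_exp)) / K] of
    the mass of the cell, so this is what a child cell can keep at most. *)
Definition lacunary_ratio : R := 1 - 2 `^ (- (1 + dual_exp)) / K.

Lemma lacunary_ratio01 : 0 < lacunary_ratio < 1.
Proof.
rewrite /lacunary_ratio subr_gt0 gtrBl divr_gt0 ?powR_gt0// andbT.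
rewrite ltr_pdivrMr// mul1r powRN; apply: lt_le_trans K1.
have r0 : 0 < 1 + dual_exp by rewrite addr_gt0// dual_exp_gt0.
have e : 1 `^ (1 + dual_exp) = 1 :> R by rewrite powR1.
rewrite invf_lt1 ?powR_gt0// -[ltLHS]e.
by apply: gt0_ltr_powR => //; rewrite ?nnegrE ?ltr1n.
Qed.

Definition hedberg_const : R :=
  ((1 - lacunary_ratio `^ gam)^-1 + (1 - lacunary_ratio `^ sobolev_exp^-1)^-1) *
  ((K `^ dual_exp^-1) `^ (p / sobolev_exp) * (K `^ sobolev_exp^-1) `^ (gam * p)).

Lemma hedberg_const_ge0 : 0 <= hedberg_const.
Proof.
have sp0 : 0 < sobolev_exp^-1 by rewrite invr_gt0 sobolev_exp_gt0.
rewrite /hedberg_const mulr_ge0 ?addr_ge0 ?invr_ge0 ?subr_ge0//.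
- by rewrite ltW// powR_lt1// lacunary_ratio01.
- by rewrite ltW// powR_lt1// lacunary_ratio01.
- by rewrite mulr_ge0 ?powR_ge0.
Qed.

(** The exponents [gam = 1 / p - 1 / q] and [- 1 / q] of the mass in the two bounds
    have opposite signs, so [lacunary_sum] applies to their minimum. *)
Lemma hedberg_sum (H P : R) (a b : nat -> R) J :
  0 <= H -> 0 <= P -> (forall j, 0 < a j) ->
  (forall j, a j.+1 <= lacunary_ratio * a j) ->
  (forall j, (j < J)%N -> b j <= K `^ dual_exp^-1 * H `^ (muck_conj / p) * a j `^ gam) ->
  (forall j, (j < J)%N -> b j <= K `^ sobolev_exp^-1 * P `^ p^-1 * a j `^ (- sobolev_exp^-1)) ->
  \sum_(j < J) b j <= hedberg_const * (H `^ (muck_conj / sobolev_exp) * P `^ gam).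
Proof.
move=> H0 P0 a0 aS ba bb.
have sp0 : 0 < sobolev_exp^-1 by rewrite invr_gt0 sobolev_exp_gt0.
have := lacunary_sum J lacunary_ratio01 gam0 sp0
  (mulr_ge0 (powR_ge0 K dual_exp^-1) (powR_ge0 H (muck_conj / p)))
  (mulr_ge0 (powR_ge0 K sobolev_exp^-1) (powR_ge0 P p^-1)) a0 aS.
have st : gam + sobolev_exp^-1 = p^-1.
  by rewrite /sobolev_exp; field; rewrite !gt_eqF.
rewrite st !invrK.
rewrite !(powRM _ (powR_ge0 _ _) (powR_ge0 _ _)).
rewrite -[(H `^ _) `^ _]powRrM -[(P `^ _) `^ _]powRrM.
rewrite (_ : muck_conj / p * (sobolev_exp^-1 * p) = muck_conj / sobolev_exp); last first.
  by field; rewrite !gt_eqF// sobolev_exp_gt0.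
rewrite (_ : p^-1 * (gam * p) = gam); last by field; rewrite gt_eqF.
rewrite (mulrC sobolev_exp^-1 p) => h.
apply: le_trans (_ : _ <= _) (le_trans h _).
  by apply: ler_sum => j _; rewrite le_min ba// bb.
by rewrite /hedberg_const -[leRHS]mulrA [X in _ <= _ * X]mulrACA.
Qed.

End exponents.

(** * The potential of one dyadic system *)

Section dyadic_potential.
Context d (T : measurableType d) (R : realType).
Variables (mu : {measure set T -> \bar R}) (idx : nat -> T -> nat).
Variables (gam p K : R) (L : nat -> R) (u : T -> R).
Hypothesis midx : forall j, measurable_fun setT (idx j).
Hypothesis refine : forall j x y, idx j.+1 x = idx j.+1 y -> idx j x = idx j y.
Hypotheses (gam0 : 0 < gam) (p1 : 1 < p) (gp : gam * p < 1) (K1 : 1 <= K).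
Hypotheses (L0 : forall j, 0 < L j) (LS : forall j, L j.+1 <= L j / 2).
Hypothesis Lcell : forall j x, mu (cell idx j x) = (L j)%:E.
Hypotheses (mu_ : measurable_fun setT u) (u0 : forall x, 0 < u x).

Let rho := dual_exp gam p.
Let rconj := muck_conj gam p.
Let sob := sobolev_exp gam p.

Definition dual_weight x : R := u x `^ (- rho^-1).

Let sig := dual_weight.

Hypothesis uoo : forall j x, (\int[mu]_(y in cell idx j x) (u y)%:E < +oo)%E.
Hypothesis sigoo : forall j x, (\int[mu]_(y in cell idx j x) (sig y)%:E < +oo)%E.
Hypothesis muck : forall j x,
  cellint mu idx u j x * cellint mu idx sig j x `^ rho <= K * L j `^ (1 + rho).

Let rho0 : 0 < rho. Proof. exact: dual_exp_gt0. Qed.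

Let sig0 x : 0 < sig x. Proof. exact: powR_gt0. Qed.

Let msig : measurable_fun setT sig. Proof. exact: measurable_fun_powR. Qed.

Let mcell j x : measurable (cell idx j x). Proof. exact: measurable_cell. Qed.

Let int_fin (v : T -> R) j x (Z : set T) : measurable_fun setT v ->
  (forall x, 0 < v x) -> (\int[mu]_(y in cell idx j x) (v y)%:E < +oo)%E ->
  measurable Z -> Z `<=` cell idx j x -> (\int[mu]_(y in Z) (v y)%:E < +oo)%E.
Proof.
move=> mv v0 voo mZ ZQ; apply: le_lt_trans voo; apply: ge0_subset_integral => //.
  by apply/measurable_EFinP; exact: measurable_funTS.
by move=> y _; rewrite lee_fin ltW.
Qed.

Lemma muckenhoupt_reverse j x (Z : set T) : measurable Z -> Z `<=` cell idx j x ->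
  fine (mu Z) `^ (1 + rho) <=
  cellint mu idx sig j x `^ rho * fine (\int[mu]_(y in Z) (u y)%:E)%E.
Proof.
move=> mZ ZQ.
have sZoo := int_fin msig sig0 (sigoo j x) mZ ZQ.
have uZoo := int_fin mu_ u0 (uoo j x) mZ ZQ.
have muZ : (mu Z < +oo)%E.
  apply: le_lt_trans (ltry (L j)); rewrite -(Lcell j x).
  by apply: le_measure => //; rewrite inE.
apply: le_trans (holder_dual_weights mZ rho0 mu_ u0 _ muZ uZoo sZoo) _ => //.
rewrite ler_wpM2r//.
  by rewrite fine_ge0// integral_ge0_real// => y; exact: ltW.
apply: le_powR; first exact: ltW.
  by rewrite fine_ge0// integral_ge0_real// => y; exact: ltW.
rewrite fine_le//.
- by rewrite ge0_fin_numE// integral_ge0_real// => y; exact: ltW.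
- by rewrite ge0_fin_numE ?sigoo// integral_ge0_real// => y; exact: ltW.
apply: ge0_subset_integral => //.
  by apply/measurable_EFinP; exact: measurable_funTS.
by move=> y _; rewrite lee_fin ltW.
Qed.

Let cellint_prod j x : L j `^ (1 + rho) <=
  cellint mu idx sig j x `^ rho * cellint mu idx u j x.
Proof.
by have := muckenhoupt_reverse (mcell j x) (@subset_refl _ _); rewrite Lcell.
Qed.

Let cellint_pos (v : T -> R) j x : (forall x, 0 < v x) ->
  cellint mu idx v j x != 0 -> (\int[mu]_(y in cell idx j x) (v y)%:E < +oo)%E ->
  (0 < \int[mu]_(y in cell idx j x) (v y)%:E < +oo)%E.
Proof.
move=> v0 + voo; rewrite voo andbT /cellint.
have : (0 <= \int[mu]_(y in cell idx j x) (v y)%:E)%E.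
  by apply: integral_ge0_real => y; exact: ltW.
rewrite le_eqVlt => /predU1P[<-|//]; by rewrite eqxx.
Qed.

Lemma cell_weight_u : cell_weight mu idx u.
Proof.
split => // [x|j x]; first exact: ltW.
apply: cellint_pos => //; apply/eqP => U0.
by have := cellint_prod j x; rewrite U0 mulr0 leNgt powR_gt0.
Qed.

Lemma cell_weight_sig : cell_weight mu idx sig.
Proof.
split => // [x|j x]; first exact: ltW.
apply: cellint_pos => //; apply/eqP => S0.
have := cellint_prod j x; rewrite S0 powR0 ?gt_eqF// mul0r leNgt powR_gt0//.
Qed.

Let U0 j x : 0 < cellint mu idx u j x. Proof. exact: cellint_gt0 cell_weight_u _ _. Qed.
Let S0 j x : 0 < cellint mu idx sig j x.
Proof. exact: cellint_gt0 cell_weight_sig _ _. Qed.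

(** The part of a cell outside a child has at least half of its measure, so by
    [muckenhoupt_reverse] it carries a definite part of its mass. *)
Lemma reverse_doubling j x :
  cellint mu idx u j.+1 x <= lacunary_ratio gam p K * cellint mu idx u j x.
Proof.
pose Z := cell idx j x `\` cell idx j.+1 x.
have mZ : measurable Z by exact: measurableD.
have ZQ : Z `<=` cell idx j x by exact: subDsetl.
(* [Z] has measure [L j - L j.+1 >= L j / 2]. *)
have QE : cell idx j x = cell idx j.+1 x `|` Z.
  by rewrite setDUK//; exact: cell_sub.
have disj : [disjoint cell idx j.+1 x & Z].
  by rewrite disj_set2E; apply/eqP; rewrite setDIK.
have muZ : fine (mu Z) = L j - L j.+1.
  have : mu (cell idx j x) = (mu (cell idx j.+1 x) + mu Z)%E.
    by rewrite {1}QE measureU// setDIK.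
  rewrite !Lcell; case: (mu Z) => [z| |]// [] ->; rewrite /=; ring.
have uZ : cellint mu idx u j x = cellint mu idx u j.+1 x +
    fine (\int[mu]_(y in Z) (u y)%:E)%E.
  rewrite /cellint [in LHS]QE ge0_integral_setU//.
  - rewrite fineD//.
    + by rewrite ge0_fin_numE ?uoo// integral_ge0_real// => y; exact: ltW.
    + rewrite ge0_fin_numE ?(int_fin mu_ u0 (uoo j x) mZ ZQ)//.
      by rewrite integral_ge0_real// => y; exact: ltW.
  - by rewrite -QE; apply/measurable_EFinP; exact: measurable_funTS.
  - by move=> y _; rewrite lee_fin ltW.
have h := muckenhoupt_reverse mZ ZQ; rewrite muZ in h.
have LS' : L j / 2 <= L j - L j.+1 by have := LS j; lra.
have {LS' h} h : (L j / 2) `^ (1 + rho) <=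
    cellint mu idx sig j x `^ rho * fine (\int[mu]_(y in Z) (u y)%:E)%E.
  by apply: le_trans h; apply: le_powR => //; rewrite ?addr_ge0 ?ltW// divr_gt0.
have := muck j x; have := U0 j x; have := S0 j x; move: h; rewrite uZ.
set A := cellint _ _ _ j.+1 _; set B := fine _; set S := cellint _ _ _ _ _.
have Lj0 : 0 <= L j by exact: ltW.
rewrite (powRM _ Lj0) ?invr_ge0// -(powR_inv1 (ler0n _ 2)) -powRrM mulN1r.
move=> h S0' AB0 hK.
have Sr0 : 0 < S `^ rho by rewrite powR_gt0.
have L1 : 0 < L j `^ (1 + rho) by rewrite powR_gt0.
have K0 : 0 < K by exact: lt_le_trans ltr01 K1.
suff : 2 `^ (- (1 + rho)) / K * (A + B) <= B.
  by rewrite /lacunary_ratio -/rho; lra.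
rewrite -(ler_pM2r Sr0); apply: (@le_trans _ _ (2 `^ (- (1 + rho)) * L j `^ (1 + rho))).
  rewrite -[leLHS]mulrA -mulrA ler_pM2l ?powR_gt0// ler_pdivrMl//.
by rewrite mulrC [leRHS]mulrC.
Qed.

Variables (g : T -> R) (J : nat).
Hypotheses (mg : measurable_fun setT g) (g0 : forall x, 0 <= g x).
Hypothesis goo : (\int[mu]_x (g x `^ p * sig x)%:E < +oo)%E.

Let M := cellmax mu idx sig g J.
Let G x : R := M x `^ (p / rconj) / u x.
Let H := cellmax mu idx u G J.
Let P := fine (\int[mu]_x (g x `^ p * sig x)%:E).

Let p0 : 0 < p. Proof. exact: lt_trans ltr01 p1. Qed.
Let rconj1 : 1 < rconj. Proof. exact: muck_conj_gt1. Qed.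
Let rconj0 : 0 < rconj. Proof. exact: lt_trans ltr01 rconj1. Qed.
Let sob0 : 0 < sob. Proof. exact: sobolev_exp_gt0. Qed.

Let M0 x : 0 <= M x.
Proof. by apply: cellmax_ge0 => // y; exact: ltW. Qed.

Let mM : measurable_fun setT M.
Proof. exact: measurable_adapted midx _ _ (@cellmax_adapted _ _ _ mu _ refine sig g J). Qed.

Let G0 x : 0 <= G x.
Proof. by rewrite divr_ge0 ?powR_ge0// ltW. Qed.

Let mG : measurable_fun setT G.
Proof.
apply: measurable_funM; first exact: measurable_fun_powR.
rewrite (_ : (fun x => _) = (fun x => u x `^ (-1))).
  exact: measurable_fun_powR.
by apply/funext => x; rewrite powR_inv1// ltW.
Qed.

Let H0 x : 0 <= H x.
Proof. by apply: cellmax_ge0 => // y; exact: ltW. Qed.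

Let GE x : G x `^ rconj * u x = M x `^ p * sig x.
Proof.
rewrite /G powRM ?powR_ge0 ?invr_ge0 ?(ltW (u0 x))// -powRrM.
rewrite divfK ?gt_eqF// -mulrA; congr (_ * _).
rewrite -[in LHS]powR_inv1 ?(ltW (u0 x))// -powRrM -{2}(powRr1 (ltW (u0 x))).
rewrite -powRD; last by rewrite (gt_eqF (u0 x)) implybT.
rewrite /sig /dual_weight; congr (_ `^ _).
have := gam_lt1 gam0 p1 gp; move: p1 gp; rewrite /rho /dual_exp /rconj /muck_conj => *.
by field; apply/andP; split; lra.
Qed.

(** [G] is chosen so that [G `^ rconj * u = M `^ p * sig] ([GE]); Doob's inequality
    is applied for the measure [u] and then for the measure [sig]. *)
Lemma cellmax_dual_bound :
  (\int[mu]_x (H x `^ rconj * u x)%:E <=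
   (doob_const rconj * (doob_const p * P))%:E)%E.
Proof.
have Pge := integral_ge0_real mu setT
  (fun x => mulr_ge0 (powR_ge0 (g x) p) (ltW (sig0 x))).
have b1 := doob_maximal midx refine cell_weight_sig p1 mg g0 goo J.
have Pfin : (\int[mu]_x (g x `^ p * sig x)%:E)%E = P%:E.
  by rewrite fineK// ge0_fin_numE.
rewrite Pfin -/M in b1.
have E : (\int[mu]_x (G x `^ rconj * u x)%:E = \int[mu]_x (M x `^ p * sig x)%:E)%E.
  by apply: eq_integral => x _; rewrite GE.
have Goo : (\int[mu]_x (G x `^ rconj * u x)%:E < +oo)%E.
  by rewrite E; apply: le_lt_trans b1 _; rewrite ltry.
have b2 := doob_maximal midx refine cell_weight_u rconj1 mG G0 Goo J.
apply: le_trans b2 _; rewrite E EFinM.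
by apply: lee_wpmul2l b1; rewrite lee_fin doob_const_ge0.
Qed.

Let F j x := cellint mu idx (fun y => g y * sig y) j x.

Let F_ge0 j x : 0 <= F j x.
Proof. by apply: cellint_ge0 => y; rewrite mulr_ge0// ltW. Qed.

Let FE j x : F j x = cellavg mu idx sig g j x * cellint mu idx sig j x.
Proof. by rewrite /cellavg divfK// gt_eqF. Qed.

Let P0 : 0 <= P.
Proof.
by rewrite fine_ge0// integral_ge0_real// => y; rewrite mulr_ge0 ?powR_ge0// ltW.
Qed.

Lemma cell_potential_norm j x : L j `^ (gam - 1) * F j x <=
  K `^ sob^-1 * P `^ p^-1 * cellint mu idx u j x `^ (- sob^-1).
Proof.
apply: (potential_le_norm p1 gp K1 (L0 j) (U0 j x) (S0 j x) _ P0 (muck j x)) => //.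
have [_ h] := cell_jensen midx cell_weight_sig p1 mg g0 goo j x.
apply: le_trans h _; rewrite ler_wpM2l ?powR_ge0//.
have q0 y : 0 <= g y `^ p * sig y by rewrite mulr_ge0 ?powR_ge0// ltW.
have mq : measurable_fun setT (fun y => g y `^ p * sig y).
  by apply: measurable_funM => //; exact: measurable_fun_powR.
apply: fine_le.
- rewrite ge0_fin_numE; last exact: integral_ge0_real.
  exact: (cell_powR_lty midx cell_weight_sig mg goo j x).
- by rewrite ge0_fin_numE//; exact: integral_ge0_real.
apply: ge0_subset_integral => //.
- exact/measurable_EFinP.
- by move=> y _; rewrite lee_fin.
Qed.

(** On the whole cell [M] is at least the average of [g] over it, so the average
    of [G] for the measure [u] controls a power of that average. *)
Lemma cell_potential_maximal j x : (j < J.+1)%N -> L j `^ (gam - 1) * F j x <=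
  K `^ rho^-1 * H x `^ (rconj / p) * cellint mu idx u j x `^ gam.
Proof.
move=> jJ; rewrite FE; set A := cellavg _ _ _ _ _ _.
have A0 : 0 <= A by apply: cellavg_ge0 => // y; exact: ltW.
apply: (potential_le_maximal gam0 p1 gp K1 (L0 j) (U0 j x) (S0 j x) A0 (H0 x)
  (muck j x)).
apply: (@le_trans _ _ (cellavg mu idx u G j x * cellint mu idx u j x)).
  rewrite /cellavg divfK ?gt_eqF// /cellint.
  have Goo : (\int[mu]_x (G x `^ rconj * u x)%:E < +oo)%E.
    have E : (\int[mu]_x (G x `^ rconj * u x)%:E = \int[mu]_x (M x `^ p * sig x)%:E)%E.
      by apply: eq_integral => z _; rewrite GE.
    by rewrite E; exact: (cellmax_powR_lty midx refine cell_weight_sig p1 mg g0 goo J).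
  have [h _] := cell_jensen midx cell_weight_u rconj1 mG G0 Goo j x.
  have Gu0 y : 0 <= G y * u y by rewrite mulr_ge0// ltW.
  rewrite -lee_fin fineK; last by rewrite ge0_fin_numE// integral_ge0_real.
  rewrite EFinM -(Lcell j x) -(integral_cst mu (mcell j x)).
  apply: le_integral_real => //.
  - by apply: measurable_funTS; exact: measurable_funM.
  - by move=> y _; exact: powR_ge0.
  move=> y yx; rewrite /G divfK ?gt_eqF//.
  apply: le_powR => //; first by rewrite divr_ge0 ?ltW.
  rewrite /A -(cellavg_adapted mu sig g yx); exact: cellavg_le_max.
rewrite ler_wpM2r ?(ltW (U0 j x))//; exact: cellavg_le_max.
Qed.

Definition dyadic_const : R :=
  hedberg_const gam p K `^ sob * (doob_const rconj * doob_const p).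

Lemma dyadic_potential_bound :
  (\int[mu]_x ((\sum_(j < J.+1) L j `^ (gam - 1) * F j x) `^ sob * u x)%:E <=
   (dyadic_const * P `^ (sob / p))%:E)%E.
Proof.
have mF j : measurable_fun setT (F j).
  exact: measurable_adapted midx _ _ (@cellint_adapted _ _ _ mu idx _ j).
have mH : measurable_fun setT H.
  exact: measurable_adapted midx _ _ (@cellmax_adapted _ _ _ mu _ refine u G J).
have S_ge0 x : 0 <= \sum_(j < J.+1) L j `^ (gam - 1) * F j x.
  by apply: sumr_ge0 => j _; rewrite mulr_ge0 ?powR_ge0.
have pt x : \sum_(j < J.+1) L j `^ (gam - 1) * F j x <=
    hedberg_const gam p K * (H x `^ (rconj / sob) * P `^ gam).
  apply: (@hedberg_sum _ gam p K gam0 p1 gp K1 (H x) P (fun j => cellint mu idx u j x)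
    (fun j => L j `^ (gam - 1) * F j x) J.+1) => //.
  - by move=> j; exact: reverse_doubling.
  - by move=> j jJ; exact: cell_potential_maximal.
  - by move=> j jJ; exact: cell_potential_norm.
have hc0 := hedberg_const_ge0 gam0 p1 gp K1.
set c := hedberg_const gam p K `^ sob * P `^ (gam * sob).
have c0 : 0 <= c by rewrite mulr_ge0 ?powR_ge0.
have mHu : measurable_fun setT (fun x => H x `^ rconj * u x).
  by apply: measurable_funM => //; exact: measurable_fun_powR.
have Hu0 x : 0 <= H x `^ rconj * u x by rewrite mulr_ge0 ?powR_ge0// ltW.
apply: (@le_trans _ _ (\int[mu]_x (c * (H x `^ rconj * u x))%:E)%E).
  apply: le_integral_real => //.
  - apply: measurable_funM => //; apply: measurable_fun_powR.
    apply: measurable_sum => j; exact: measurable_funM.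
  - exact: measurable_funM.
  - by move=> x _; rewrite mulr_ge0 ?powR_ge0// ltW.
  move=> x _; rewrite mulrA ler_wpM2r ?(ltW (u0 x))//.
  apply: le_trans (le_powR (ltW sob0) (S_ge0 x) (pt x)) _.
  rewrite (powRM _ hc0 (mulr_ge0 (powR_ge0 _ _) (powR_ge0 _ _))).
  rewrite (powRM _ (powR_ge0 _ _) (powR_ge0 _ _)) -!powRrM divfK ?gt_eqF//.
  by rewrite /c -mulrA (mulrC (P `^ _)).
rewrite integralZ_real//.
apply: le_trans (lee_wpmul2l _ cellmax_dual_bound) _; first by rewrite lee_fin.
rewrite -EFinM lee_fin le_eqVlt; apply/orP; left; apply/eqP.
have -> : sob / p = gam * sob + 1.
  rewrite /sob /sobolev_exp; field; rewrite !gt_eqF// subr_gt0//.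
rewrite powRD; last first.
  by apply/implyP => /eqP e; have := addr_gt0 (mulr_gt0 gam0 sob0) (@ltr01 R); rewrite e ltxx.
rewrite powRr1// /dyadic_const /c; ring.
Qed.


End dyadic_potential.

(** * Boxes and distances in the Euclidean space *)

Local Notation coord := Defs.coord.

Section boxes.
Variable R : realType.
Local Notation TR := (measurableTypeR R).

Definition box n (I : 'I_n -> set TR) : set (n.-tuple TR) :=
  [set t | forall i, I i (tnth t i)].

Lemma measurable_box n (I : 'I_n -> set TR) :
  (forall i, measurable (I i)) -> measurable (box I).
Proof.
move=> mI.
rewrite (_ : box I = \bigcap_(i in [set: 'I_n]) (@tnth _ TR ^~ i @^-1` I i)).
  apply: fin_bigcap_measurable => // i _.
  by rewrite -[X in measurable X]setTI; exact: measurable_tnth.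
by apply/seteqP; split => [t It i _|t It i]; [exact: It|exact: (It i)].
Qed.

Lemma borel_lebesgue_box n (I : 'I_n -> set TR) (l : R) :
  (forall i, measurable (I i)) ->
  (forall i, @lebesgue_measure R (I i) = l%:E) ->
  @borel_lebesgue R n (box I) = (l ^+ n)%:E.
Proof.
elim: n I => [I _ _|n IH I mI lI].
  rewrite /= diracE mem_set//= => -[] //.
rewrite /= /cons_measure /pushforward.
have -> : @tcons R n @^-1` box I = I ord0 `*` box (fun i => I (lift ord0 i)).
  apply/seteqP; split => [[x t] /= h|[x t] /= [h0 h] i].
    split; first exact: (h ord0).
    by move=> i; have := h (lift ord0 i); rewrite tnthS.
  case: (unliftP ord0 i) => [k|] ->; last exact: h0.
  by rewrite tnthS; exact: h.
rewrite product_measure1E//; last by apply: measurable_box => i; exact: mI.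
rewrite (IH _ (fun i => mI _) (fun i => lI _)) exprS EFinM; congr (_ * _)%E.
exact: lI.
Qed.

End boxes.

Section Rn_measure.
Variables (R : realType) (n : nat).
Local Notation TR := (measurableTypeR R).
Local Notation T := (Rn R n).

Lemma measurable_Rn (A : set (n.-tuple TR)) :
  measurable A -> measurable (A : set T).
Proof. by move=> mA; apply: sub_caratheodory; exact: sub_sigma_algebra. Qed.

Lemma lebesgue_RnE (A : set (n.-tuple TR)) : measurable A ->
  @lebesgue_Rn R n (A : set T) = @borel_lebesgue R n A.
Proof.
by move=> mA; rewrite /lebesgue_Rn /completed_measure_extension measurable_mu_extE.
Qed.

Lemma measurable_coord i : measurable_fun [set: T] (fun x : T => coord x i).
Proof.
move=> _ B mB; rewrite setTI; apply: measurable_Rn.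
rewrite -[X in measurable X]setTI; exact: (@measurable_tnth _ TR n i).
Qed.

Lemma measurable_box_Rn (I : 'I_n -> set TR) :
  (forall i, measurable (I i)) -> measurable ([set x | forall i, I i (coord x i)] : set T).
Proof. by move=> mI; apply: measurable_Rn; exact: measurable_box. Qed.

Lemma lebesgue_Rn_box (I : 'I_n -> set TR) (l : R) :
  (forall i, measurable (I i)) ->
  (forall i, @lebesgue_measure R (I i) = l%:E) ->
  @lebesgue_Rn R n [set x | forall i, I i (coord x i)] = (l ^+ n)%:E.
Proof.
move=> mI lI; rewrite lebesgue_RnE; last exact: measurable_box.
exact: borel_lebesgue_box.
Qed.

Lemma lebesgue_cube (a : T) (r : R) : 0 <= r ->
  @lebesgue_Rn R n [set x | forall i, coord a i <= coord x i <= coord a i + r] =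
  (r ^+ n)%:E.
Proof.
move=> r0; rewrite -(@lebesgue_Rn_box (fun i => `[coord a i, coord a i + r]%classic)).
- by congr (lebesgue_Rn _); apply/seteqP; split => x /= h i; have := h i; rewrite in_itv.
- by move=> i; exact: measurable_itv.
move=> i; rewrite lebesgue_measure_itv/= lte_fin ltrDl.
move: r0; rewrite le_eqVlt => /predU1P[<-|r0]; first by rewrite ltxx.
by rewrite r0 -EFinD addrC addKr.
Qed.

Lemma measurable_cube (a : T) (r : R) :
  measurable ([set x | forall i, coord a i <= coord x i <= coord a i + r] : set T).
Proof.
rewrite (_ : mkset _ = [set x | forall i, (`[coord a i, coord a i + r]%classic : set TR) (coord x i)]).
  apply: (@measurable_box_Rn (fun i => `[coord a i, coord a i + r]%classic)) => i.
  exact: measurable_itv.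
by apply/seteqP; split => x /= h i; have := h i; rewrite in_itv.
Qed.

Lemma coord_le_dist (x y : T) i : `|coord x i - coord y i| <= eucl_dist x y.
Proof.
rewrite -sqrtr_sqr /eucl_dist ler_sqrt; last by apply: sumr_ge0 => j _; exact: sqr_ge0.
by rewrite (bigD1 i)//= lerDl; apply: sumr_ge0 => j _; exact: sqr_ge0.
Qed.

Lemma eucl_dist_ge0 (x y : T) : 0 <= eucl_dist x y.
Proof. exact: sqrtr_ge0. Qed.

Lemma measurable_eucl_dist (x : T) : measurable_fun [set: T] (eucl_dist x).
Proof.
rewrite (_ : eucl_dist x =
    fun y => (\sum_(i < n) (coord x i - coord y i) ^+ 2) `^ 2^-1).
  apply: measurable_fun_powR; apply: measurable_sum => i.
  have mc : measurable_fun [set: T] (fun y : T => coord x i - coord y i).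
    exact: measurable_funB (measurable_cst _) (measurable_coord i).
  exact: measurable_funX mc.
apply/funext => y; rewrite powR12_sqrt//.
by apply: sumr_ge0 => j _; exact: sqr_ge0.
Qed.

Hypothesis n0 : (0 < n)%N.

Lemma eucl_dist_eq0_null (x : T) :
  @lebesgue_Rn R n [set y | eucl_dist x y = 0] = 0%E.
Proof.
apply/eqP; rewrite eq_le measure_ge0 andbT.
have <- : @lebesgue_Rn R n [set y | forall i, coord x i <= coord y i <= coord x i + 0] = 0%E.
  by rewrite lebesgue_cube// expr0n eqn0Ngt n0.
apply: le_measure; rewrite ?inE.
- rewrite -[X in measurable X]setTI.
  exact: (measurable_eucl_dist x measurableT (measurable_set1 0)).
- exact: measurable_cube.
move=> y /= h i; have := coord_le_dist x y i; rewrite h normr_le0 subr_eq0 addr0.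
by move=> /eqP ->; rewrite lexx.
Qed.

End Rn_measure.

(** * Adjacent dyadic grids *)

Section grids.
Variables (R : realType) (n : nat).
Local Notation T := (Rn R n).
Implicit Types (L : R) (t : {ffun 'I_n -> bool}).

(** The coordinate in units of the side [L / 2 ^+ j], after a shift by a third of
    the coarsest side in the directions selected by [t].  The shift does not
    depend on [j], so that the cells are nested. *)
Definition grid_coord L t j (x : T) i : R :=
  (coord x i + (t i)%:R * (L / 3)) * (2 ^+ j / L).

Definition grid_index L t j (x : T) : nat :=
  pickle [ffun i => Num.floor (grid_coord L t j x i)].

Lemma grid_index_eqP L t j x y : grid_index L t j x = grid_index L t j y <->
  forall i, Num.floor (grid_coord L t j x i) = Num.floor (grid_coord L t j y i).
Proof.
split => [/(pcan_inj pickleK) e i|e]; last by congr pickle; apply/ffunP => i; rewrite !ffunE.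
by have := congr1 (fun f : {ffun 'I_n -> int} => f i) e; rewrite !ffunE.
Qed.

Lemma floor_half (a b : R) : Num.floor (2 * a) = Num.floor (2 * b) ->
  Num.floor a = Num.floor b.
Proof.
have key (c d : R) : Num.floor (2 * c) = Num.floor (2 * d) -> Num.floor d <= Num.floor c.
  move=> e; rewrite floor_ge_int.
  have : (2 * Num.floor d)%:~R <= 2 * c.
    by rewrite -floor_ge_int e floor_ge_int intrM ler_pM2l// floor_le.
  by rewrite intrM ler_pM2l.
by move=> e; apply/eqP; rewrite eq_le !key.
Qed.

Lemma grid_index_refine L t j x y : grid_index L t j.+1 x = grid_index L t j.+1 y ->
  grid_index L t j x = grid_index L t j y.
Proof.
move=> /grid_index_eqP h; apply/grid_index_eqP => i; apply: floor_half.
have E z : 2 * grid_coord L t j z i = grid_coord L t j.+1 z i.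
  by rewrite /grid_coord exprS; ring.
by rewrite !E.
Qed.

Section side.
Variable L : R.
Hypothesis L0 : 0 < L.

Definition grid_corner t j (x : T) i : R :=
  (Num.floor (grid_coord L t j x i))%:~R * (L / 2 ^+ j) - (t i)%:R * (L / 3).

Definition grid_itv t j x i : set (measurableTypeR R) :=
  `[grid_corner t j x i, grid_corner t j x i + L / 2 ^+ j[%classic.

Lemma gridcell t j x :
  cell (grid_index L t) j x = [set y | forall i, grid_itv t j x i (coord y i)].
Proof.
have l0 : 0 < L / 2 ^+ j by rewrite divr_gt0// exprn_gt0.
apply/seteqP; split => y; rewrite /cell /grid_itv /grid_corner/= => h.
  move/grid_index_eqP : h => h i; have := floor_itv (grid_coord L t j y i); rewrite h.
  set m := Num.floor _; rewrite in_itv/= /grid_coord.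
  have -> : 2 ^+ j / L = (L / 2 ^+ j)^-1 by rewrite invf_div.
  rewrite ler_pdivlMr// ltr_pdivrMr// intrD mulrDl mul1r; lra.
apply/grid_index_eqP => i; have := h i; set m := Num.floor (grid_coord L t j x i).
rewrite in_itv/= => hi; apply: floor_def; rewrite /grid_coord.
have -> : 2 ^+ j / L = (L / 2 ^+ j)^-1 by rewrite invf_div.
rewrite ler_pdivlMr// ltr_pdivrMr// intrD mulrDl mul1r; lra.
Qed.

Lemma measurable_grid_index t j : measurable_fun [set: T] (grid_index L t j).
Proof.
move=> _ B _; rewrite setTI.
have -> : grid_index L t j @^-1` B =
    \bigcup_(m in B) (grid_index L t j @^-1` [set m]).
  by apply/seteqP; split => [x Bx|x [m Bm] /= xm]; [exists (grid_index L t j x)|rewrite /preimage/= xm].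
apply: bigcup_measurable => m _.
have [[x xm]|e] := pselect (exists x, grid_index L t j x = m).
  have -> : grid_index L t j @^-1` [set m] = cell (grid_index L t) j x by rewrite /cell xm.
  rewrite gridcell; apply: (@measurable_box_Rn _ _ (grid_itv t j x)) => i; exact: measurable_itv.
have -> : grid_index L t j @^-1` [set m] = set0 by apply/seteqP; split => // x xm; case: e; exists x.
exact: measurable0.
Qed.

Lemma lebesgue_gridcell t j x :
  @lebesgue_Rn R n (cell (grid_index L t) j x) = ((L / 2 ^+ j) ^+ n)%:E.
Proof.
have l0 : 0 < L / 2 ^+ j by rewrite divr_gt0// exprn_gt0.
rewrite gridcell; apply: (@lebesgue_Rn_box _ _ (grid_itv t j x)) => i; first exact: measurable_itv.
by rewrite lebesgue_measure_itv/= lte_fin ltrDl l0 -EFinD addrC addKr.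
Qed.

Lemma gridcell_cube t j x : exists a : T, cell (grid_index L t) j x `<=`
  [set y | forall i, coord a i <= coord y i <= coord a i + L / 2 ^+ j].
Proof.
exists [tuple grid_corner t j x i | i < n].
rewrite gridcell => y /= h i; have := h i; rewrite /grid_itv/= in_itv/= /coord tnth_mktuple.
by move=> /andP[-> /ltW].
Qed.

(** If integers [m] and [m'] separated [a] from [b] and their translates, then
    [m' - m] would be at distance less than [1 / 3] from [2 ^+ j / 3]; hence [3]
    would divide [2 ^+ j]. *)
Lemma third_trick (a b : R) j : `|a - b| < 3^-1 ->
  Num.floor a = Num.floor b \/
  Num.floor (a + 2 ^+ j / 3) = Num.floor (b + 2 ^+ j / 3).
Proof.
wlog ab : a b / a <= b.
  move=> h; have [/h//|/ltW/h] := leP a b.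
  by rewrite distrC => /[apply] -[] ->; [left|right].
rewrite ler0_norm ?subr_le0// => abl.
have [->|ne1] := eqVneq (Num.floor a) (Num.floor b); first by left.
set c := 2 ^+ j / 3.
have [->|ne2] := eqVneq (Num.floor (a + c)) (Num.floor (b + c)); first by right.
exfalso.
have lt1 : Num.floor a < Num.floor b by rewrite lt_neqAle ne1 le_floor.
have lt2 : Num.floor (a + c) < Num.floor (b + c).
  by rewrite lt_neqAle ne2 le_floor// lerD2r.
rewrite floor_lt_int in lt1; rewrite floor_lt_int in lt2.
have := floor_le b; have := floor_le (b + c).
move: lt1 lt2; set m := Num.floor b; set m' := Num.floor (b + c) => h1 h2 h3 h4.
have cE : 3 * c = 2 ^+ j by rewrite /c; field.
have h : `|(3 * (m' - m) - 2 ^+ j)%:~R : R| < 1.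
  rewrite intrD intrM intrB intrN rmorphXn/= -cE ltr_norml.
  by apply/andP; split; lra.
have /eqP : (3 * (m' - m) - 2 ^+ j = 0 :> int).
  apply/eqP; rewrite -normr_le0 -ltzD1 add0r -(ltr_int R).
  by rewrite intr_norm.
rewrite subr_eq0 => /eqP e.
have : (3 %| 2 ^+ j)%Z by apply/dvdzP; exists (m' - m); rewrite mulrC.
rewrite dvdzE abszX /= => d3.
by have := d3; rewrite Euclid_dvdX.
Qed.

(** In each direction one of the two grids does not separate [x] from [y]; the
    choices for different directions are independent, whence [2 ^ n] grids. *)
Lemma shifted_cell (x y : T) j : eucl_dist x y < L / 2 ^+ j / 3 ->
  exists t, cell (grid_index L t) j x y.
Proof.
move=> xy; have l0 : 0 < L / 2 ^+ j by rewrite divr_gt0// exprn_gt0.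
(* Shift exactly in the directions where the unshifted grid separates [x] and [y]. *)
pose t0 := [ffun i : 'I_n => false].
pose t := [ffun i => Num.floor (grid_coord L t0 j y i) != Num.floor (grid_coord L t0 j x i)].
exists t; apply/grid_index_eqP => i.
have [e|e] := eqVneq (Num.floor (grid_coord L t0 j y i)) (Num.floor (grid_coord L t0 j x i)).
  have ti : t i = t0 i by rewrite !ffunE e eqxx.
  by move: e; rewrite /grid_coord ti.
have d : `|grid_coord L t0 j y i - grid_coord L t0 j x i| < 3^-1.
  rewrite /grid_coord !ffunE/= mul0r !addr0 -mulrBl normrM.
  rewrite (gtr0_norm (x := 2 ^+ j / L)) ?divr_gt0 ?exprn_gt0//.
  rewrite -(ltr_pM2r l0) -mulrA (_ : 2 ^+ j / L * (L / 2 ^+ j) = 1); last first.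
    by field; rewrite !gt_eqF// exprn_gt0.
  rewrite mulr1 distrC (le_lt_trans (coord_le_dist x y i))//.
  by rewrite mulrC.
have [/eqP|] := third_trick j d; first by rewrite (negbTE e).
have ti : t i = true by rewrite ffunE e.
have E z : grid_coord L t j z i = grid_coord L t0 j z i + 2 ^+ j / 3.
  rewrite /grid_coord ti ffunE/= mul0r mul1r addr0; field.
  by rewrite gt_eqF.
by rewrite !E.
Qed.

Lemma dyadic_scale (r : R) J : L / 2 ^+ J.+1 / 3 <= r < L / 3 ->
  exists2 j, (j < J.+1)%N & L / 2 ^+ j.+1 / 3 <= r < L / 2 ^+ j / 3.
Proof.
elim: J => [|J IH] /andP[h1 h2]; first by exists 0%N => //; rewrite h1 expr0 divr1.
have [h|h] := leP (L / 2 ^+ J.+1 / 3) r; last by exists J.+1 => //; rewrite h1 h.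
by have [|j jJ hj] := IH; [rewrite h h2|exists j => //; exact: ltn_trans jJ _].
Qed.

End side.
End grids.

(** * The kernel and the dyadic cells *)

Section kernel.
Variables (R : realType) (n : nat).
Local Notation T := (Rn R n).
Local Notation grid := {ffun 'I_n -> bool}.
Local Notation leb := (@lebesgue_Rn R n).
Variables (s : R) (f : T -> R).
Hypotheses (s0 : 0 < s) (mf : measurable_fun [set: T] f) (f0 : forall x, 0 <= f x).

Definition annulus (x : T) (a b : R) : set T := [set y | a <= eucl_dist x y < b].

Lemma measurable_annulus x a b : measurable (annulus x a b).
Proof.
rewrite (_ : annulus x a b = eucl_dist x @^-1` `[a, b[%classic).
  rewrite -[X in measurable X]setTI.
  exact: (measurable_eucl_dist x measurableT (measurable_itv _)).
by apply/seteqP; split => y; rewrite /annulus/= in_itv.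
Qed.

Lemma annulus_mono x k m : (k <= m)%N ->
  annulus x (2 ^- k.+1) (2 ^+ k) `<=` annulus x (2 ^- m.+1) (2 ^+ m).
Proof.
move=> km y /andP[h1 h2]; apply/andP; split.
  apply: le_trans h1; rewrite lef_pV2 ?posrE ?exprn_gt0// ler_eXn2l ?ltr1n//.
by rewrite (lt_le_trans h2)// ler_eXn2l ?ltr1n.
Qed.

Definition riesz_kernel (x y : T) : \bar R := ((eucl_dist x y `^ s)%:E^-1)%E.

Lemma riesz_kernelE x y : riesz_kernel x y =
  if eucl_dist x y == 0 then +oo%E else (eucl_dist x y `^ (- s))%:E.
Proof. by rewrite /riesz_kernel inver powR_eq0 (gt_eqF s0) andbT powRN. Qed.

Lemma riesz_kernel_ge0 x y : (0 <= riesz_kernel x y)%E.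
Proof. by rewrite riesz_kernelE; case: ifPn => // _; rewrite lee_fin powR_ge0. Qed.

Lemma measurable_riesz_kernel x : measurable_fun [set: T] (riesz_kernel x).
Proof.
rewrite (_ : riesz_kernel x = fun y => if eucl_dist x y == 0 then +oo%E
    else (eucl_dist x y `^ (- s))%:E); last by apply/funext => y; rewrite riesz_kernelE.
apply: measurable_fun_ifT.
- exact: measurable_fun_eqr (measurable_eucl_dist x) (measurable_cst _).
- exact: measurable_cst.
- by apply/measurable_EFinP; exact: measurable_fun_powR (measurable_eucl_dist x).
Qed.

Definition riesz_term (x y : T) : \bar R := ((f y)%:E * riesz_kernel x y)%E.

Lemma riesz_term_ge0 x y : (0 <= riesz_term x y)%E.
Proof. by rewrite mule_ge0 ?lee_fin// riesz_kernel_ge0. Qed.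

Lemma measurable_riesz_term x : measurable_fun [set: T] (riesz_term x).
Proof.
by apply: emeasurable_funM; [exact/measurable_EFinP|exact: measurable_riesz_kernel].
Qed.

Lemma riesz_termE x y : eucl_dist x y != 0 ->
  riesz_term x y = (f y * eucl_dist x y `^ (- s))%:E.
Proof. by move=> xy; rewrite /riesz_term riesz_kernelE (negbTE xy) -EFinM. Qed.

(** For [y] in the annulus some scale [j] has side comparable with the distance
    to [x], and one of the grids has a cell at this scale that contains both
    points; that term of the sum alone dominates the kernel. *)
Lemma truncated_potential_le L J x : 0 < L ->
  (\int[leb]_(y in annulus x (L / 2 ^+ J.+1 / 3) (L / 3)) riesz_term x y <=
   (6 `^ s)%:E * \sum_(tj : grid * 'I_J.+1) ((L / 2 ^+ tj.2) `^ (- s))%:E *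
     \int[leb]_(y in cell (grid_index L tj.1) tj.2 x) (f y)%:E)%E.
Proof.
move=> L0; set A := annulus _ _ _.
pose F (tj : grid * 'I_J.+1) (y : T) : \bar R :=
  (((L / 2 ^+ tj.2) `^ (- s))%:E * ((EFin \o f) \_ (cell (grid_index L tj.1) tj.2 x)) y)%E.
have mcell (tj : grid * 'I_J.+1) : measurable (cell (grid_index L tj.1) tj.2 x : set T).
  exact: (measurable_cell (fun j => measurable_grid_index L0 tj.1 j)).
have mF0 (tj : grid * 'I_J.+1) : measurable_fun [set: T] ((EFin \o f) \_ (cell (grid_index L tj.1) tj.2 x)).
  apply/(measurable_restrictT _ _).1 => //.
  by apply/measurable_EFinP; exact: measurable_funTS.
have p0 (tj : grid * 'I_J.+1) y : (0 <= ((EFin \o f) \_ (cell (grid_index L tj.1) tj.2 x)) y)%E.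
  by apply: erestrict_ge0 => z _; rewrite lee_fin.
have mF tj : measurable_fun [set: T] (F tj).
  exact: (measurable_funeM _ (mF0 tj)).
have F0 tj y : (0 <= F tj y)%E by rewrite mule_ge0 ?lee_fin ?powR_ge0.
have -> : (\sum_(tj : grid * 'I_J.+1) ((L / 2 ^+ tj.2) `^ (- s))%:E *
     \int[leb]_(y in cell (grid_index L tj.1) tj.2 x) (f y)%:E =
    \int[leb]_y \sum_tj F tj y)%E.
  rewrite ge0_integral_sum//; apply: eq_bigr => tj _.
  rewrite /F ge0_integralZl//; last by rewrite lee_fin powR_ge0.
  by rewrite -integral_mkcond.
have S0 y : (0 <= \sum_tj F tj y)%E by apply: sume_ge0 => tj _; exact: F0.
have mS : measurable_fun [set: T] (fun y => \sum_tj F tj y)%E.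
  by apply: emeasurable_sum => tj; exact: mF.
have c0 : (0 <= (6 `^ s)%:E :> \bar R)%E by rewrite lee_fin powR_ge0.
have E2 := ge0_integralZl leb measurableT mS (fun y _ => S0 y) c0.
rewrite -[leRHS]E2.
rewrite [leLHS]integral_mkcond; apply: le_integral_nonmeasurable => y.
  by apply: erestrict_ge0 => z _; exact: riesz_term_ge0.
rewrite patchE; case: ifPn => [|_]; last first.
  by rewrite mule_ge0 ?lee_fin ?powR_ge0// sume_ge0.
rewrite inE => /= /dyadic_scale[j jJ /andP[h1 h2]].
have [t ty] := shifted_cell L0 h2.
have l0 : 0 < L / 2 ^+ j by rewrite divr_gt0// exprn_gt0.
have l6 : L / 2 ^+ j / 6 = L / 2 ^+ j.+1 / 3.
  by rewrite exprS; field; rewrite gt_eqF// exprn_gt0.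
have d0 : 0 < eucl_dist x y by apply: lt_le_trans h1; rewrite -l6 divr_gt0.
rewrite riesz_termE ?gt_eqF//.
apply: (@le_trans _ _ ((6 `^ s)%:E * F (t, Ordinal jJ) y)%E).
  rewrite /F patchE mem_set//= -!EFinM lee_fin [leLHS]mulrC mulrA ler_wpM2r//.
  have -> : 6 `^ s * (L / 2 ^+ j) `^ (- s) = (L / 2 ^+ j / 6) `^ (- s).
    rewrite [RHS]powRM ?invr_ge0 ?(ltW l0)// mulrC -[6^-1]powR_inv1// -powRrM.
    by rewrite mulN1r opprK.
  have l60 : 0 < L / 2 ^+ j / 6 by rewrite divr_gt0.
  rewrite !powRN lef_pV2 ?posrE ?powR_gt0//.
  by apply: le_powR; [exact: ltW|exact: ltW|rewrite l6].
rewrite lee_wpmul2l ?lee_fin ?powR_ge0// (bigD1 (t, Ordinal jJ))//=.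
by rewrite leeDl// sume_ge0.
Qed.

(** The annuli exhaust the complement of a null set. *)
Lemma potential_annulus_cvg x : (0 < n)%N ->
  (\int[leb]_(y in annulus x (2 ^- N.+1) (2 ^+ N)) riesz_term x y @[N --> \oo] -->
   \int[leb]_y riesz_term x y)%E.
Proof.
move=> n0; pose D : set T := [set y | eucl_dist x y = 0].
have mD : measurable D.
  rewrite -[X in measurable X]setTI.
  exact: (measurable_eucl_dist x measurableT (measurable_set1 0)).
have -> : (\int[leb]_y riesz_term x y =
    \int[leb]_(y in \bigcup_N annulus x (2 ^- N.+1) (2 ^+ N)) riesz_term x y)%E.
  have -> : \bigcup_N annulus x (2 ^- N.+1) (2 ^+ N) = setT `\` D.
    apply/seteqP; split => [y [N _] /andP[h _]|y [_ /eqP y0]].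
      split => // y0; move: h; rewrite y0 leNgt => /negP; apply.
      by rewrite invr_gt0 exprn_gt0.
    have {y0} y0 : 0 < eucl_dist x y by rewrite lt_neqAle eq_sym y0 eucl_dist_ge0.
    have big (r : R) : exists N, r < 2 ^+ N.
      have [m hm] : exists m : nat, r < m%:R.
        exists (Num.bound `|r|).
        exact: le_lt_trans (ler_norm r) (archi_boundP (normr_ge0 r)).
      exists m; apply: lt_trans hm _; rewrite -natrX ltr_nat; exact: ltn_expl.
    have [N1 h1] := big (eucl_dist x y); have [N2 h2] := big (eucl_dist x y)^-1.
    exists (maxn N1 N2) => //; apply/andP; split.
      rewrite invf_ple ?posrE ?exprn_gt0// ltW// (lt_le_trans h2)//.
      by rewrite ler_eXn2l ?ltr1n// (leq_trans (leq_maxr N1 N2)).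
    by rewrite (lt_le_trans h1)// ler_eXn2l ?ltr1n// leq_maxl.
  exact: (ge0_negligible_integral mD measurableT (measurable_riesz_term x)
    (fun y _ => riesz_term_ge0 x y) (eucl_dist_eq0_null n0 x)).
apply: ge0_nondecreasing_set_cvg_integral.
- by move=> k m km; apply/subsetPset; exact: annulus_mono.
- by move=> N; exact: measurable_annulus.
- by move=> N; apply: measurable_funTS; exact: measurable_riesz_term.
- by move=> N y _; exact: riesz_term_ge0.
Qed.


End kernel.

(** * From logarithmic averages to the Muckenhoupt condition *)

Lemma measurable_lne (R : realType) : measurable_fun [set: \bar R] (@lne R).
Proof.
rewrite (_ : @lne R = fun y => if y == +oo%E then +oo%E else
    if fine y <= 0 then -oo%E else (ln (fine y))%:E); last first.
  by apply/funext => -[y| |] //=; rewrite lexx.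
apply: measurable_fun_ifT.
- exact: measurable_fun_eqe.
- exact: measurable_cst.
apply: measurable_fun_ifT.
- by apply: measurable_fun_ler => //; exact: fine_measurable.
- exact: measurable_cst.
apply/measurable_EFinP; apply: (measurableT_comp (@measurable_ln R)).
exact: fine_measurable.
Qed.

Section log_weights.
Context d (T : measurableType d) (R : realType).
Variable mu : {measure set T -> \bar R}.

Section density.
Variables (W : T -> \bar R) (w : T -> R) (N D : set T).
Hypotheses (mW : measurable_fun [set: T] W) (mw : measurable_fun [set: T] w).
Hypotheses (w0 : forall x, 0 < w x) (mD : measurable D).
Hypotheses (mN : measurable N) (N0 : mu N = 0%E).
Hypothesis WE : forall x, ~ N x -> W x = (w x)%:E.

Lemma integral_density : (\int[mu]_(x in D) W x = \int[mu]_(x in D) (w x)%:E)%E.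
Proof.
apply: ae_eq_integral => //; first exact: measurable_funTS.
  by apply/measurable_EFinP; exact: measurable_funTS.
by exists N; split => // x /= h; apply: contrapT => Nx; apply: h => _; rewrite WE.
Qed.

Lemma integral_abs_density :
  (\int[mu]_(x in D) `|W x| = \int[mu]_(x in D) (w x)%:E)%E.
Proof.
apply: ae_eq_integral => //.
- by apply: measurable_funTS; exact: measurableT_comp.
- by apply/measurable_EFinP; exact: measurable_funTS.
exists N; split => // x /= h; apply: contrapT => Nx; apply: h => _.
by rewrite WE// abse_EFin gtr0_norm.
Qed.

Lemma integral_lne_density :
  (\int[mu]_(x in D) (@lne R \o W) x = \int[mu]_(x in D) (ln (w x))%:E)%E.
Proof.
apply: ae_eq_integral => //.
- by apply: measurable_funTS; apply: measurableT_comp mW; exact: measurable_lne.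
- apply/measurable_EFinP; apply: measurable_funTS.
  exact: (measurableT_comp (@measurable_ln R)).
exists N; split => // x /= h; apply: contrapT => Nx; apply: h => _.
by rewrite WE//= leNgt w0.
Qed.

End density.

Lemma ln_le_self (x : R) : 0 < x -> ln x <= x.
Proof.
move=> x0; have := expR_ge1Dx (ln x); rewrite lnK ?posrE//; lra.
Qed.

(** [ln u <= u], and [- ln u] is [rho] times the logarithm of the dual weight. *)
Lemma integrable_ln (D : set T) (u : T -> R) (rho : R) : measurable D -> 0 < rho ->
  measurable_fun [set: T] u -> (forall x, 0 < u x) ->
  (\int[mu]_(x in D) (u x)%:E < +oo)%E ->
  (\int[mu]_(x in D) (u x `^ (- rho^-1))%:E < +oo)%E ->
  mu.-integrable D (fun x => (ln (u x))%:E).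
Proof.
move=> mD rho0 mu_ u0 uoo voo.
pose v x := u x `^ (- rho^-1).
have v0 x : 0 < v x by exact: powR_gt0.
have mv : measurable_fun [set: T] v by exact: measurable_fun_powR.
have mvD : measurable_fun D (fun x => rho * v x).
  by apply: measurable_funTS; exact: measurable_funM.
have muD : measurable_fun D u by exact: measurable_funTS.
have q0 x : 0 <= rho * v x by rewrite mulr_ge0// ltW.
have p0 x : 0 <= u x by exact: ltW.
have iuv : mu.-integrable D (EFin \o (fun x => u x + rho * v x)).
  apply/integrableP; split; first by apply/measurable_EFinP; exact: measurable_funD.
  under eq_integral => x _ do rewrite /= ger0_norm ?addr_ge0//.
  rewrite integralD_real// integralZ_real ?(ltW rho0)//.
  - by apply: lte_add_pinfty => //; apply: lte_mul_pinfty => //; rewrite lee_fin ltW.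
  - exact: measurable_funTS.
  - by move=> x; exact: ltW.
apply: le_integrable iuv => //.
  apply/measurable_EFinP; apply: measurable_funTS.
  exact: (measurableT_comp (@measurable_ln R)).
move=> x _; rewrite /= lee_fin.
have hu := ln_le_self (u0 x); have hv := ln_le_self (v0 x).
have hv' : - ln (u x) <= rho * v x.
  rewrite -(ler_pM2l rho0) in hv; apply: le_trans hv.
  by rewrite /v ln_powR mulrA mulrN mulfV ?gt_eqF// mulN1r.
rewrite (@ger0_norm _ (u x + _)) ?addr_ge0//.
rewrite ler_norml; apply/andP; split.
  by rewrite lerNl (le_trans hv')// lerDr.
by rewrite (le_trans hu)// lerDl.
Qed.

(** The logarithm of [u `^ (- rho^-1)] is [- rho^-1] times that of [u].  Hence the
    exponential factors cancel when the second hypothesis is raised to the power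
    [rho] and multiplied by the first one. *)
Lemma muckenhoupt_of_log (D : set T) (u : T -> R) (rho K1 K2 z : R) :
  measurable D -> 0 < rho -> 0 < z ->
  measurable_fun [set: T] u -> (forall x, 0 < u x) ->
  (\int[mu]_(x in D) (u x)%:E < +oo)%E ->
  (\int[mu]_(x in D) (u x `^ (- rho^-1))%:E < +oo)%E ->
  0 <= K1 -> 0 <= K2 ->
  fine (\int[mu]_(x in D) (u x)%:E) / z *
    expR (- (fine (\int[mu]_(x in D) (ln (u x))%:E) / z)) <= K1 ->
  fine (\int[mu]_(x in D) (u x `^ (- rho^-1))%:E) / z *
    expR (- (fine (\int[mu]_(x in D) (ln (u x `^ (- rho^-1)))%:E) / z)) <= K2 ->
  fine (\int[mu]_(x in D) (u x)%:E) *
    fine (\int[mu]_(x in D) (u x `^ (- rho^-1))%:E) `^ rho <=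
  K1 * K2 `^ rho * z `^ (1 + rho).
Proof.
move=> mD rho0 z0 mu_ u0 uoo voo K10 K20.
have il := integrable_ln mD rho0 mu_ u0 uoo voo.
have -> : fine (\int[mu]_(x in D) (ln (u x `^ (- rho^-1)))%:E) =
    - rho^-1 * fine (\int[mu]_(x in D) (ln (u x))%:E).
  under eq_integral do rewrite ln_powR EFinM.
  by rewrite integralZl// fineM//; exact: integrable_fin_num.
have : 0 <= fine (\int[mu]_(x in D) (u x)%:E).
  by rewrite fine_ge0// integral_ge0_real// => x; exact: ltW.
have : 0 <= fine (\int[mu]_(x in D) (u x `^ (- rho^-1))%:E).
  by rewrite fine_ge0// integral_ge0_real// => x; exact: powR_ge0.
move: (fine (\int[mu]_(x in D) (u x)%:E))
  (fine (\int[mu]_(x in D) (u x `^ (- rho^-1))%:E))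
  (fine (\int[mu]_(x in D) (ln (u x))%:E)) => U V l V0 U0 k1 k2.
have k3 : (V / z) `^ rho * expR (l / z) <= K2 `^ rho.
  have <- : (V / z * expR (- (- rho^-1 * l / z))) `^ rho = (V / z) `^ rho * expR (l / z).
    rewrite powRM ?expR_ge0 ?divr_ge0 ?(ltW z0)//; congr (_ * _).
    rewrite -expRM; congr expR; field.
    by rewrite !gt_eqF.
  by apply: (le_powR (ltW rho0) _ k2); rewrite mulr_ge0 ?expR_ge0// divr_ge0// ltW.
have k4 : (U / z) * (V / z) `^ rho <= K1 * K2 `^ rho.
  have := ler_pM _ _ k1 k3.
  rewrite mulrACA -expRD addNr expR0 mulr1; apply.
    by rewrite mulr_ge0 ?expR_ge0// divr_ge0// ltW.
  by rewrite mulr_ge0 ?expR_ge0 ?powR_ge0.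
rewrite powRD; last by rewrite (gt_eqF z0) implybT.
rewrite powRr1 ?(ltW z0)//.
have := ler_wpM2r (mulr_ge0 (ltW z0) (powR_ge0 z rho)) k4.
rewrite mulrACA divfK ?gt_eqF// -powRM ?divr_ge0 ?(ltW z0)// divfK ?gt_eqF//.
Qed.

End log_weights.

Section cubes.
Variables (R : realType) (n : nat).
Local Notation T := (Rn R n).
Local Notation leb := (@lebesgue_Rn R n).

Definition cube (a : T) (r : R) : set T :=
  [set x | forall i, coord a i <= coord x i <= coord a i + r].

Lemma compact_cube a r : compact_Rn (cube a r).
Proof.
rewrite /compact_Rn.
have -> : [set \row_i coord x i | x in cube a r] =
    [set v : 'rV[R]_n | forall i, `[coord a i, coord a i + r]%classic (v ord0 i)].
  apply/seteqP; split => [_ [x ax <-] i|v h] /=.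
    by rewrite mxE in_itv; exact: ax.
  exists ([tuple v ord0 i | i < n] : T).
    by move=> i; have := h i; rewrite /= in_itv /coord tnth_mktuple.
  by apply/rowP => i; rewrite mxE /coord tnth_mktuple.
apply: (@rV_compact _ n (fun i => `[coord a i, coord a i + r]%classic)) => i.
exact: segment_compact.
Qed.

Section density.
Variables (W : T -> \bar R) (w : T -> R) (N : set T).
Hypotheses (AW : A_infty W) (w0 : forall x, 0 < w x).
Hypothesis mw : measurable_fun [set: T] w.
Hypotheses (mN : measurable N) (N0 : leb N = 0%E).
Hypothesis WE : forall x, ~ N x -> W x = (w x)%:E.

Let mW : measurable_fun [set: T] W. Proof. by case: AW => -[[]]. Qed.

Lemma cube_integral_lty a r : (\int[leb]_(x in cube a r) (w x)%:E < +oo)%E.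
Proof.
have mQ : measurable (cube a r) by exact: measurable_cube.
have [[[_ loc] _] _] := AW; have := loc _ (@compact_cube a r).
by rewrite (integral_abs_density mW mw w0 mQ mN N0 WE).
Qed.

(** The supremum in the A_infinity condition, read on real numbers: off a null set
    the weight is finite and positive, and its logarithm is integrable. *)
Lemma cube_log_average : exists K : R, 0 <= K /\ forall a r, 0 < r ->
  leb.-integrable (cube a r) (fun x => (ln (w x))%:E) ->
  fine (\int[leb]_(x in cube a r) (w x)%:E) / r ^+ n *
    expR (- (fine (\int[leb]_(x in cube a r) (ln (w x))%:E) / r ^+ n)) <= K.
Proof.
have [_] := AW; set S := ereal_sup _ => Soo.
have main a r : 0 < r -> leb.-integrable (cube a r) (fun x => (ln (w x))%:E) ->
  ((fine (\int[leb]_(x in cube a r) (w x)%:E) / r ^+ n *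
    expR (- (fine (\int[leb]_(x in cube a r) (ln (w x))%:E) / r ^+ n)))%:E <= S)%E.
  move=> r0 il; have mQ : measurable (cube a r) by exact: measurable_cube.
  have V0 : r ^+ n != 0 by rewrite gt_eqF// exprn_gt0.
  have lQ : leb (cube a r) = (r ^+ n)%:E by exact: (lebesgue_cube a (ltW r0)).
  apply: ereal_sup_ubound; exists (cube a r) => /=; first by exists a, r.
  rewrite /average (integral_lne_density mW mw w0 mQ mN N0 WE).
  rewrite (integral_density mW mw mQ mN N0 WE) lQ inver (negbTE V0).
  have f1 := integrable_fin_num mQ il.
  have f2 : (\int[leb]_(x in cube a r) (w x)%:E)%E \is a fin_num.
    rewrite ge0_fin_numE; first exact: cube_integral_lty.
    by apply: integral_ge0_real => x; exact: ltW.
  move: f1 f2; move: (\int[leb]_(x in cube a r) (ln (w x))%:E)%E => [l| |]//.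
  by move: (\int[leb]_(x in cube a r) (w x)%:E)%E => [U| |]//.
exists (fine S `|` 0)%O; split; first by rewrite lexUr.
move=> a r r0 il; have := main a r r0 il.
case: (S) Soo => [K| |] // _; rewrite lee_fin => /le_trans; apply.
by rewrite leUl.
Qed.

End density.

Lemma muckenhoupt_cubes (W1 W2 : T -> \bar R) (u : T -> R) (N : set T) (rho : R) :
  0 < rho -> A_infty W1 -> A_infty W2 -> (forall x, 0 < u x) ->
  measurable_fun [set: T] u -> measurable N -> leb N = 0%E ->
  (forall x, ~ N x -> W1 x = (u x)%:E) ->
  (forall x, ~ N x -> W2 x = (u x `^ (- rho^-1))%:E) ->
  [/\ forall a r, (\int[leb]_(x in cube a r) (u x)%:E < +oo)%E,
      forall a r, (\int[leb]_(x in cube a r) (u x `^ (- rho^-1))%:E < +oo)%E &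
  exists2 K : R, 1 <= K & forall a r, 0 < r ->
    fine (\int[leb]_(x in cube a r) (u x)%:E) *
    fine (\int[leb]_(x in cube a r) (u x `^ (- rho^-1))%:E) `^ rho <=
    K * (r ^+ n) `^ (1 + rho)].
Proof.
move=> rho0 A1 A2 u0 mu_ mN N0 E1 E2.
pose v x := u x `^ (- rho^-1).
have v0 x : 0 < v x by exact: powR_gt0.
have mv : measurable_fun [set: T] v by exact: measurable_fun_powR.
have uoo a r := cube_integral_lty A1 u0 mu_ mN N0 E1 a r.
have voo a r := cube_integral_lty A2 v0 mv mN N0 E2 a r.
have [K1 [K10 h1]] := cube_log_average A1 u0 mu_ mN N0 E1.
have [K2 [K20 h2]] := cube_log_average A2 v0 mv mN N0 E2.
split => //; exists (Num.max 1 (K1 * K2 `^ rho)); first by rewrite le_max lexx.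
move=> a r r0; have mQ : measurable (cube a r) by exact: measurable_cube.
have il := integrable_ln mQ rho0 mu_ u0 (uoo a r) (voo a r).
have il2 : leb.-integrable (cube a r) (fun x => (ln (v x))%:E).
  rewrite (_ : (fun x => _) = fun x => ((- rho^-1)%:E * (ln (u x))%:E)%E).
    exact: (integrableZl mQ _ il).
  by apply/funext => x; rewrite /v ln_powR EFinM.
apply: (@le_trans _ _ (K1 * K2 `^ rho * (r ^+ n) `^ (1 + rho))); last first.
  by rewrite ler_wpM2r ?powR_ge0// le_max lexx orbT.
exact: (muckenhoupt_of_log mQ rho0 (exprn_gt0 n r0) mu_ u0 (uoo a r) (voo a r)
  K10 K20 (h1 a r r0 il) (h2 a r r0 il2)).
Qed.

End cubes.

(** * Passage to all scales *)

Section limits.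
Variable R : realType.

Lemma limn_einf_sup_einfs (a : (\bar R)^nat) :
  limn_einf a = ereal_sup (range (einfs a)).
Proof. by rewrite limn_einf_lim; apply/cvg_lim => //; exact: cvg_einfs_sup. Qed.

Lemma limn_einf_le (a : (\bar R)^nat) (B : \bar R) :
  (forall k, a k <= B)%E -> (limn_einf a <= B)%E.
Proof.
move=> aB; rewrite limn_einf_sup_einfs; apply: ge_ereal_sup => _ [k _ <-].
by apply: le_trans (aB k); apply: ereal_inf_lbound; exists k => /=.
Qed.

Lemma le_limn_einf (a : (\bar R)^nat) (b : \bar R) k :
  (forall m, (k <= m)%N -> b <= a m)%E -> (b <= limn_einf a)%E.
Proof.
move=> ba; rewrite limn_einf_sup_einfs.
apply: (@le_trans _ _ (einfs a k)); last by apply: ereal_sup_ubound; exists k.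
by apply: le_ereal_inf_tmp => _ [m /= km <-]; exact: ba.
Qed.

(** Solved for [phi k], the bounds pass to the limit by mere order. *)
Lemma poweR_lim_le (phi : (\bar R)^nat) (Phi s : \bar R) (u q : R) :
  0 < q -> 0 < u -> (forall k, 0 <= phi k)%E -> phi @ \oo --> Phi ->
  (forall k, phi k `^ q * u%:E <= s)%E -> (Phi `^ q * u%:E <= s)%E.
Proof.
move=> q0 u0 phi0 phiP hs.
have Phi0 : (0 <= Phi)%E.
  have <- := cvg_lim (@ereal_hausdorff R) phiP.
  by apply: lime_ge; [apply/cvg_ex; exists Phi|exact: nearW].
case: s hs => [s| |] hs; last 2 first.
- by rewrite leey.
- have := hs 0%N; rewrite leeNy_eq => /eqP e.
  have : (0 <= phi 0%N `^ q * u%:E)%E by rewrite mule_ge0 ?poweR_ge0// lee_fin ltW.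
  by rewrite e.
have phis k : (phi k <= ((s / u) `^ q^-1)%:E)%E.
  have := hs k; have := phi0 k; case: (phi k) => [r| |]//.
  - rewrite lee_fin => r0; rewrite poweR_EFin -EFinM !lee_fin -ler_pdivlMr// => h.
    have := le_powR (s := q^-1) _ (powR_ge0 _ _) h.
    by rewrite -powRrM mulfV ?gt_eqF// powRr1//; apply; rewrite invr_ge0 ltW.
  - by move=> _; rewrite poweRyr ?gt_eqF// gt0_mulye ?lte_fin.
have PhiS : (Phi <= ((s / u) `^ q^-1)%:E)%E.
  have <- := cvg_lim (@ereal_hausdorff R) phiP.
  by apply: lime_le; [apply/cvg_ex; exists Phi|exact: nearW].
have s0 : 0 <= s / u.
  rewrite divr_ge0 ?(ltW u0)// -lee_fin; apply: le_trans (hs 0%N).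
  by rewrite mule_ge0 ?poweR_ge0// lee_fin ltW.
move: Phi0 PhiS; case: (Phi) => [r| |]//; rewrite !lee_fin => r0 rs.
rewrite -ler_pdivlMr//.
apply: le_trans (le_powR (ltW q0) r0 rs) _.
by rewrite -powRrM mulVf ?gt_eqF// powRr1.
Qed.

End limits.

Section majorant.
Context d (T : measurableType d) (R : realType).
Variable mu : {measure set T -> \bar R}.

(** Fatou's lemma for the measurable majorants [w k]; the potentials [X], [Phi]
    and [phi] are only compared with them. *)
Lemma fatou_majorant (N : set T) (X Phi : T -> \bar R) (phi : nat -> T -> \bar R)
    (w : nat -> T -> R) (u : T -> R) (q : R) (B : \bar R) :
  measurable N -> mu N = 0%E -> 0 < q ->
  measurable_fun [set: T] u -> (forall x, 0 < u x) ->
  (forall k, measurable_fun [set: T] (w k)) -> (forall k x, 0 <= w k x) ->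
  (forall x, 0 <= X x)%E -> (forall x, ~ N x -> X x <= Phi x `^ q * (u x)%:E)%E ->
  (forall k x, 0 <= phi k x <= (w k x)%:E)%E ->
  (forall x, nondecreasing_seq (phi ^~ x)) ->
  (forall x, phi k x @[k --> \oo] --> Phi x) ->
  (forall k, \int[mu]_x (w k x `^ q * u x)%:E <= B)%E ->
  (\int[mu]_x X x <= B)%E.
Proof.
move=> mN N0 q0 mu_ u0 mw w0 X0 XPhi phiw nd cvgphi wB.
(* The second term is infinite on the exceptional null set and integrates to 0. *)
pose v k x : \bar R := ((w k x `^ q * u x)%:E + +oo * (\1_N x)%:E)%E.
have w'0 k x : 0 <= w k x `^ q * u x by rewrite mulr_ge0 ?powR_ge0 ?ltW.
have mwq k : measurable_fun [set: T] (fun x => (w k x `^ q * u x)%:E).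
  apply/measurable_EFinP; apply: measurable_funM => //.
  exact: measurable_fun_powR.
have mi : measurable_fun [set: T] (fun x => +oo * (\1_N x)%:E : \bar R)%E.
  by apply: measurable_funeM; apply/measurable_EFinP; exact: measurable_indic.
have i0 x : (0 <= +oo * (\1_N x)%:E :> \bar R)%E.
  by rewrite mule_ge0// lee_fin.
have mv k : measurable_fun [set: T] (v k) by exact: emeasurable_funD.
have v0 k x : (0 <= v k x)%E by rewrite adde_ge0 ?lee_fin.
have vB k : (\int[mu]_x v k x <= B)%E.
  rewrite ge0_integralD//; last by move=> x _; rewrite lee_fin.
  rewrite [X in (_ + X)%E](_ : _ = 0%E) ?adde0//.
  rewrite ge0_integralZl//.
    by rewrite integral_indic// setIT N0 mule0.
  by apply/measurable_EFinP; exact: measurable_indic.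
apply: (@le_trans _ _ (\int[mu]_x limn_einf (v ^~ x))%E).
  apply: le_integral_nonmeasurable => // x.
  have [Nx|Nx] := pselect (N x).
    apply: (@le_limn_einf _ _ _ 0%N) => m _.
    by rewrite /v indicE mem_set// mule1 addey// leey.
  apply: le_trans (XPhi x Nx) _.
  apply: (@poweR_lim_le _ (phi ^~ x)) => //.
    by move=> k; have /andP[] := phiw k x.
  move=> k; apply: (@le_limn_einf _ _ _ k) => m km.
  rewrite /v indicE memNset// mule0 adde0 EFinM -poweR_EFin.
  apply: lee_wpmul2r; first by rewrite lee_fin ltW.
  have /andP[h0 _] := phiw k x; have /andP[_ h1] := phiw m x.
  apply: gt0_ler_poweR; first exact: ltW.
  - by rewrite in_itv/= h0 leey.
  - by rewrite in_itv/= leey andbT lee_fin.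
  - exact: le_trans (nd x _ _ km) h1.
apply: le_trans (fatou mu measurableT mv (fun k x _ => v0 k x)) _.
exact: limn_einf_le.
Qed.

End majorant.

(** * The weighted estimate for the potential *)

Section power_sums.
Variable R : realType.

(** Each [a i] is at most [(\sum_i a i `^ q) `^ q^-1]. *)
Lemma powR_sum_le (I : finType) (a : I -> R) (q : R) : 0 < q ->
  (forall i, 0 <= a i) ->
  (\sum_i a i) `^ q <= #|I|%:R `^ q * \sum_i a i `^ q.
Proof.
move=> q0 a0; have S0 : 0 <= \sum_i a i `^ q.
  by apply: sumr_ge0 => i _; exact: powR_ge0.
have le i : a i <= (\sum_i a i `^ q) `^ q^-1.
  have qi : 0 <= q^-1 by rewrite invr_ge0 ltW.
  have := @le_powR _ q^-1 (a i `^ q) (\sum_i a i `^ q) qi (powR_ge0 _ _).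
  rewrite -powRrM mulfV ?gt_eqF// powRr1//; apply.
  by rewrite (bigD1 i)//= lerDl; apply: sumr_ge0 => j _; exact: powR_ge0.
have := @le_powR _ q (\sum_i a i) (#|I|%:R * (\sum_i a i `^ q) `^ q^-1) (ltW q0).
rewrite powRM ?powR_ge0// -powRrM mulVf ?gt_eqF// powRr1//; apply.
  by apply: sumr_ge0 => i _.
by rewrite -sumr_const mulr_suml; apply: ler_sum => i _; rewrite mul1r.
Qed.

Lemma integral_powR_sum_le d (T : measurableType d) (mu : {measure set T -> \bar R})
    (I : finType) (w : I -> T -> R) (u : T -> R) (q B : R) : 0 < q ->
  measurable_fun [set: T] u -> (forall x, 0 <= u x) ->
  (forall i, measurable_fun [set: T] (w i)) -> (forall i x, 0 <= w i x) ->
  (forall i, \int[mu]_x (w i x `^ q * u x)%:E <= B%:E)%E ->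
  (\int[mu]_x ((\sum_i w i x) `^ q * u x)%:E <= (#|I|%:R `^ q * (#|I|%:R * B))%:E)%E.
Proof.
move=> q0 mu_ u0 mw w0 wB.
have mwu i : measurable_fun [set: T] (fun x => w i x `^ q * u x).
  by apply: measurable_funM => //; exact: measurable_fun_powR.
have wu0 i x : 0 <= w i x `^ q * u x by rewrite mulr_ge0 ?powR_ge0.
have mS : measurable_fun [set: T] (fun x => \sum_i w i x `^ q * u x).
  exact: measurable_sum.
have S0 x : 0 <= \sum_i w i x `^ q * u x by apply: sumr_ge0 => i _.
have c0 : 0 <= #|I|%:R `^ q :> R by exact: powR_ge0.
apply: (@le_trans _ _ (\int[mu]_x (#|I|%:R `^ q * \sum_i w i x `^ q * u x)%:E)%E).
  apply: le_integral_real => //.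
  - apply: measurable_funM => //; apply: measurable_fun_powR.
    exact: measurable_sum.
  - exact: measurable_funM.
  - by move=> x _; rewrite mulr_ge0 ?powR_ge0.
  move=> x _; rewrite -mulr_suml mulrA ler_wpM2r//.
  exact: powR_sum_le.
rewrite integralZ_real// EFinM; apply: lee_wpmul2l => //.
have -> : (\int[mu]_x (\sum_i w i x `^ q * u x)%:E =
    \sum_i \int[mu]_x (w i x `^ q * u x)%:E)%E.
  under eq_integral do rewrite -sumEFin.
  rewrite ge0_integral_sum//; first by move=> i; exact/measurable_EFinP.
  by move=> i x _; rewrite lee_fin.
rewrite mulr_natl -sumr_const -sumEFin; exact: lee_sum.
Qed.

Lemma integral_powR_scale_le d (T : measurableType d) (mu : {measure set T -> \bar R})
    (w u : T -> R) (c q B : R) : 0 <= c ->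
  measurable_fun [set: T] u -> (forall x, 0 <= u x) ->
  measurable_fun [set: T] w -> (forall x, 0 <= w x) ->
  (\int[mu]_x (w x `^ q * u x)%:E <= B%:E)%E ->
  (\int[mu]_x ((c * w x) `^ q * u x)%:E <= (c `^ q * B)%:E)%E.
Proof.
move=> c0 mu_ u0 mw w0 wB.
under eq_integral => x _ do rewrite powRM// -mulrA.
rewrite integralZ_real ?powR_ge0//.
- by rewrite EFinM; apply: lee_wpmul2l => //; rewrite lee_fin powR_ge0.
- by apply: measurable_funM => //; exact: measurable_fun_powR.
- by move=> x; rewrite mulr_ge0 ?powR_ge0.
Qed.

End power_sums.

Section core.
Variables (R : realType) (n : nat) (alpha p K : R).
Local Notation T := (Rn R n).
Local Notation leb := (@lebesgue_Rn R n).
Local Notation grid := {ffun 'I_n -> bool}.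
Variable u : T -> R.
Hypotheses (a0 : 0 < alpha) (an : alpha < n%:R).
Hypotheses (p1 : 1 < p) (ap : alpha / n%:R * p < 1) (K1 : 1 <= K).

Let gam := alpha / n%:R.
Let s := n%:R - alpha.
Let q := sobolev_exp gam p.
Let sig := dual_weight gam p u.

Hypotheses (mu_ : measurable_fun [set: T] u) (u0 : forall x, 0 < u x).
Hypothesis ucube : forall a r, (\int[leb]_(x in cube a r) (u x)%:E < +oo)%E.
Hypothesis sigcube : forall a r, (\int[leb]_(x in cube a r) (sig x)%:E < +oo)%E.
Hypothesis muck : forall a r, 0 < r ->
  fine (\int[leb]_(x in cube a r) (u x)%:E) *
  fine (\int[leb]_(x in cube a r) (sig x)%:E) `^ dual_exp gam p <=
  K * (r ^+ n) `^ (1 + dual_exp gam p).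

Let n0 : (0 < n)%N.
Proof. by rewrite -(ltr_nat R); exact: lt_trans a0 an. Qed.

Let nR0 : 0 < n%:R :> R. Proof. by rewrite ltr0n. Qed.
Let s0 : 0 < s. Proof. by rewrite subr_gt0. Qed.
Let gam0 : 0 < gam. Proof. exact: divr_gt0. Qed.
Let q0 : 0 < q. Proof. exact: sobolev_exp_gt0. Qed.

Let sig0 x : 0 < sig x. Proof. exact: powR_gt0. Qed.
Let msig : measurable_fun [set: T] sig. Proof. exact: measurable_fun_powR. Qed.

Section grid_bounds.
Variables (L : R) (t : grid).
Hypothesis L0 : 0 < L.

Let side0 j : 0 < L / 2 ^+ j. Proof. by rewrite divr_gt0// exprn_gt0. Qed.

Let mcell j x : measurable (cell (grid_index L t) j x : set T).
Proof. exact: (measurable_cell (measurable_grid_index L0 t) j x). Qed.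

Let cell_le_cube (v : T -> R) a j x : measurable_fun [set: T] v ->
  (forall x, 0 < v x) -> cell (grid_index L t) j x `<=` cube a (L / 2 ^+ j) ->
  (\int[leb]_(y in cell (grid_index L t) j x) (v y)%:E <=
   \int[leb]_(y in cube a (L / 2 ^+ j)) (v y)%:E)%E.
Proof.
move=> mv v0 ha; apply: ge0_subset_integral.
- exact: mcell.
- exact: measurable_cube.
- by apply/measurable_EFinP; exact: measurable_funTS.
- by move=> y _; rewrite lee_fin ltW.
- exact: ha.
Qed.

Lemma grid_cell_lty (v : T -> R) j x : measurable_fun [set: T] v ->
  (forall x, 0 < v x) ->
  (forall a r, \int[leb]_(y in cube a r) (v y)%:E < +oo)%E ->
  (\int[leb]_(y in cell (grid_index L t) j x) (v y)%:E < +oo)%E.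
Proof.
move=> mv v0 voo; have [a ha] := gridcell_cube L0 t j x.
exact: le_lt_trans (cell_le_cube mv v0 ha) (voo _ _).
Qed.

Lemma grid_muckenhoupt j x :
  cellint leb (grid_index L t) u j x * cellint leb (grid_index L t) sig j x `^ dual_exp gam p <=
  K * ((L / 2 ^+ j) ^+ n) `^ (1 + dual_exp gam p).
Proof.
have [a ha] := gridcell_cube L0 t j x.
have le_cube (v : T -> R) : measurable_fun [set: T] v -> (forall x, 0 < v x) ->
    (forall a r, \int[leb]_(y in cube a r) (v y)%:E < +oo)%E ->
    cellint leb (grid_index L t) v j x <= fine (\int[leb]_(y in cube a (L / 2 ^+ j)) (v y)%:E).
  move=> mv v0 voo; have v0' y : 0 <= v y by exact: ltW.
  apply: fine_le.
  - rewrite ge0_fin_numE; last exact: integral_ge0_real.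
    exact: grid_cell_lty.
  - rewrite ge0_fin_numE; last exact: integral_ge0_real.
    exact: voo.
  exact: cell_le_cube.
apply: le_trans (muck a (side0 j)).
apply: ler_pM.
- by apply: cellint_ge0 => y; exact: ltW.
- exact: powR_ge0.
- exact: le_cube.
apply: le_powR.
- exact: ltW (dual_exp_gt0 p1 ap).
- by apply: cellint_ge0 => y; exact: ltW.
- exact: le_cube.
Qed.

Let side_half j : (L / 2 ^+ j.+1) ^+ n <= (L / 2 ^+ j) ^+ n / 2.
Proof.
have -> : L / 2 ^+ j.+1 = L / 2 ^+ j / 2.
  by rewrite exprS; field; rewrite gt_eqF// exprn_gt0.
rewrite exprMn ler_wpM2l ?exprn_ge0 ?(ltW (side0 j))//.
case: (n) n0 => // m _; rewrite exprS ler_piMr ?invr_ge0// exprn_ile1 ?invr_ge0//.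
by rewrite invf_le1// ler1n.
Qed.

Variable g : T -> R.
Hypotheses (mg : measurable_fun [set: T] g) (g0 : forall x, 0 <= g x).
Hypothesis goo : (\int[leb]_x (g x `^ p * sig x)%:E < +oo)%E.

(** [gam = alpha / n] turns powers of the measure of a cell into powers of its
    side. *)
Lemma side_powR j : ((L / 2 ^+ j) ^+ n) `^ (gam - 1) = (L / 2 ^+ j) `^ (- s).
Proof.
rewrite -powR_mulrn ?(ltW (side0 j))// -powRrM; congr (_ `^ _).
by rewrite /gam /s; field; rewrite gt_eqF.
Qed.

Definition grid_potential J x : R := \sum_(j < J.+1)
  ((L / 2 ^+ j) ^+ n) `^ (gam - 1) * cellint leb (grid_index L t) (fun y => g y * sig y) j x.

Lemma grid_potential_ge0 J x : 0 <= grid_potential J x.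
Proof.
apply: sumr_ge0 => j _; apply: mulr_ge0; first exact: powR_ge0.
by apply: cellint_ge0 => y; apply: mulr_ge0 => //; exact: ltW.
Qed.

Lemma measurable_grid_potential J : measurable_fun [set: T] (grid_potential J).
Proof.
apply: measurable_sum => j; apply: measurable_funM; first exact: measurable_cst.
exact: (measurable_adapted (measurable_grid_index L0 t)
  (@cellint_adapted _ _ _ leb (grid_index L t) _ j)).
Qed.

Lemma grid_cell_integral j x :
  (\int[leb]_(y in cell (grid_index L t) j x) (g y * sig y)%:E =
   (cellint leb (grid_index L t) (fun y => g y * sig y) j x)%:E)%E.
Proof.
have ws := cell_weight_sig (measurable_grid_index L0 t) p1 ap
  (fun j => exprn_gt0 n (side0 j)) (lebesgue_gridcell L0 t) mu_ u0
  (fun j x => grid_cell_lty j x mu_ u0 ucube)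
  (fun j x => grid_cell_lty j x msig sig0 sigcube).
have [h _] := cell_jensen (measurable_grid_index L0 t) ws p1 mg g0 goo j x.
rewrite /cellint fineK// ge0_fin_numE//; apply: integral_ge0_real => y.
by apply: mulr_ge0 => //; exact: ltW.
Qed.

Lemma grid_potential_bound J :
  (\int[leb]_x (grid_potential J x `^ q * u x)%:E <=
   (dyadic_const gam p K *
    fine (\int[leb]_x (g x `^ p * sig x)%:E) `^ (q / p))%:E)%E.
Proof.
exact: (dyadic_potential_bound (measurable_grid_index L0 t) (@grid_index_refine _ _ L t)
  gam0 p1 ap K1 (fun j => exprn_gt0 n (side0 j)) side_half
  (lebesgue_gridcell L0 t) mu_ u0
  (fun j x => grid_cell_lty j x mu_ u0 ucube)
  (fun j x => grid_cell_lty j x msig sig0 sigcube)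
  grid_muckenhoupt J mg g0 goo).
Qed.

End grid_bounds.

Variable g : T -> R.
Hypotheses (mg : measurable_fun [set: T] g) (g0 : forall x, 0 <= g x).
Hypothesis goo : (\int[leb]_x (g x `^ p * sig x)%:E < +oo)%E.

Definition potential_const : R :=
  (6 `^ s) `^ q * (#|{: grid}|%:R `^ q * (#|{: grid}|%:R * dyadic_const gam p K)).

(** With this coarsest side and [2 N + 1] levels, the truncated kernel is the kernel
    restricted to distances between [2 ^- N.+1] and [2 ^+ N]. *)
Let side N : R := 3 * 2 ^+ N.
Let sideN0 N : 0 < side N. Proof. by rewrite mulr_gt0// exprn_gt0. Qed.

Let W N x : R := \sum_(t : grid) grid_potential (side N) t g (N.*2) x.

Lemma potential_bound (N : set T) (X : T -> \bar R) :
  measurable N -> leb N = 0%E -> (forall x, 0 <= X x)%E ->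
  (forall x, ~ N x -> X x <=
    (\int[leb]_y riesz_term s (fun y => (g y * sig y)%R) x y) `^ q * (u x)%:E)%E ->
  (\int[leb]_x X x <= (potential_const *
    fine (\int[leb]_x (g x `^ p * sig x)%:E) `^ (q / p))%:E)%E.
Proof.
move=> mN N0 X0 hX; set P := fine _.
have mf : measurable_fun [set: T] (fun y => g y * sig y) by exact: measurable_funM.
have f0 y : 0 <= g y * sig y by apply: mulr_ge0 => //; exact: ltW.
have mW k : measurable_fun [set: T] (W k).
  by apply: measurable_sum => t; apply: measurable_grid_potential; exact: sideN0.
have W0 k x : 0 <= W k x by apply: sumr_ge0 => t _; exact: grid_potential_ge0.
have WB k : (\int[leb]_x (W k x `^ q * u x)%:E <= (#|{: grid}|%:R `^ q *
    (#|{: grid}|%:R * (dyadic_const gam p K * P `^ (q / p))))%:E)%E.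
  apply: (integral_powR_sum_le q0 mu_ (fun x => ltW (u0 x))).
  - by move=> t; apply: measurable_grid_potential; exact: sideN0.
  - by move=> t x; exact: grid_potential_ge0.
  - by move=> t; exact: (grid_potential_bound t (sideN0 k) mg g0 goo).
pose f := fun y => g y * sig y.
pose phi k x := (\int[leb]_(y in annulus x (2 ^- k.+1) (2 ^+ k)) riesz_term s f x y)%E.
have mw' k : measurable_fun [set: T] (fun x => 6 `^ s * W k x).
  exact: measurable_funM (measurable_cst _) (mW k).
have w0' k x : 0 <= 6 `^ s * W k x by apply: mulr_ge0; [exact: powR_ge0|exact: W0].
have phiw k x : (0 <= phi k x <= (6 `^ s * W k x)%:E)%E.
  apply/andP; split; first by apply: integral_ge0 => y _; exact: riesz_term_ge0.
  have := @truncated_potential_le R n s f s0 mf f0 (side k) k.*2 x (sideN0 k).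
  have -> : side k / 2 ^+ (k.*2).+1 / 3 = 2 ^- k.+1.
    rewrite /side -addnn -addnS exprD; field.
    by rewrite !gt_eqF// exprn_gt0.
  have -> : side k / 3 = 2 ^+ k by rewrite /side; field.
  move=> /le_trans; apply; rewrite EFinM; apply: lee_wpmul2l.
    by rewrite lee_fin; exact: powR_ge0.
  rewrite /W /grid_potential pair_bigA/= -sumEFin; apply: lee_sum => -[t j] _ /=.
  by rewrite (grid_cell_integral t (sideN0 k) mg g0 goo) -EFinM lee_fin side_powR.
have nd x : nondecreasing_seq (phi ^~ x).
  move=> k m km; apply: ge0_subset_integral.
  - exact: measurable_annulus.
  - exact: measurable_annulus.
  - by apply: measurable_funTS; exact: measurable_riesz_term.
  - by move=> y _; exact: riesz_term_ge0.
  exact: annulus_mono.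
have cvgphi x : phi k x @[k --> \oo] --> (\int[leb]_y riesz_term s f x y)%E.
  exact: potential_annulus_cvg.
have wB k : (\int[leb]_x ((6 `^ s * W k x) `^ q * u x)%:E <=
    (potential_const * P `^ (q / p))%:E)%E.
  have -> : potential_const * P `^ (q / p) = (6 `^ s) `^ q * (#|{: grid}|%:R `^ q *
      (#|{: grid}|%:R * (dyadic_const gam p K * P `^ (q / p)))).
    by rewrite /potential_const !mulrA.
  exact: (integral_powR_scale_le (powR_ge0 _ _) mu_ (fun x => ltW (u0 x)) (mW k)
    (W0 k) (WB k)).
exact: (fatou_majorant mN N0 q0 mu_ u0 mw' w0' X0 hX phiw nd cvgphi wB).
Qed.

End core.

(** * Powers of the distance to a set *)

Section finite_part.
Context d (T : measurableType d) (R : realType).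
Variable mu : {measure set T -> \bar R}.
Variables (f D : T -> \bar R) (dl : T -> R) (N : set T) (p : R).
Hypotheses (p0 : 0 < p) (mf : measurable_fun [set: T] f).
Hypotheses (mD : measurable_fun [set: T] D) (D0 : forall x, (0 <= D x)%E).
Hypotheses (mdl : measurable_fun [set: T] dl) (dl0 : forall x, 0 < dl x).
Hypotheses (mN : measurable N) (N0 : mu N = 0%E).
Hypothesis DE : forall x, ~ N x -> D x = (dl x)%:E.
Hypothesis Ifin : (\int[mu]_x (`|f x| `^ p * D x) < +oo)%E.

Let maf : measurable_fun [set: T] (fun x => `|f x|%E).
Proof. exact: measurableT_comp. Qed.

Let mff : measurable_fun [set: T] (fun x => fine `|f x|%E).
Proof. by apply: (measurableT_comp _ maf); exact: fine_measurable. Qed.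

Let mI : measurable_fun [set: T] (fun x => `|f x| `^ p * D x)%E.
Proof.
apply: emeasurable_funM => //.
exact: (measurableT_comp (measurable_poweR p) maf).
Qed.

(** Where [`|f x|] is infinite and [x] is outside [N], the integrand of [Ifin] is
    infinite; its integral is finite. *)
Lemma ae_finite_part : {ae mu, forall x, `|f x|%E = (fine `|f x|%E)%:E}.
Proof.
have iI : mu.-integrable [set: T] (fun x => `|f x| `^ p * D x)%E.
  apply/integrableP; split => //; apply: le_lt_trans Ifin.
  apply: ge0_le_integral => //; first exact: measurableT_comp.
  by move=> x _; rewrite gee0_abs// mule_ge0// poweR_ge0.
have aN : {ae mu, forall x, ~ N x}.
  by exists N; split => // x /= /contrapT.
apply: filterS2 (integrable_ae measurableT iI) aN => x /(_ I) + Nx.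
rewrite DE//; have := abse_ge0 (f x); case: `|f x|%E => [r| |]//= _.
by rewrite gt_eqF// gt0_mulye// lte_fin.
Qed.

Lemma integral_finite_part :
  (\int[mu]_x (`|f x| `^ p * D x) =
   \int[mu]_x (fine `|f x|%E `^ p * dl x)%:E)%E.
Proof.
apply: ge0_ae_eq_integral => //.
- apply/measurable_EFinP; apply: measurable_funM => //.
  exact: measurable_fun_powR.
- by move=> x _; rewrite mule_ge0// poweR_ge0.
- by move=> x _; rewrite lee_fin mulr_ge0 ?powR_ge0// ltW.
have aN : {ae mu, forall x, ~ N x}.
  by exists N; split => // x /= /contrapT.
by apply: filterS2 ae_finite_part aN => x h Nx _; rewrite h DE// EFinM.
Qed.

Lemma integral_mul_finite_part (k : T -> \bar R) :
  measurable_fun [set: T] k -> (forall x, 0 <= k x)%E ->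
  (`| \int[mu]_x (f x * k x) | <= \int[mu]_x ((fine `|f x|%E)%:E * k x))%E.
Proof.
move=> mk k0.
have mfk : measurable_fun [set: T] (fun x => f x * k x)%E by exact: emeasurable_funM.
apply: le_trans (le_abse_integral mu measurableT mfk) _.
rewrite le_eqVlt; apply/orP; left; apply/eqP.
apply: ge0_ae_eq_integral => //.
- exact: measurableT_comp.
- by apply: emeasurable_funM => //; exact/measurable_EFinP.
- by move=> x _; rewrite mule_ge0// lee_fin fine_ge0.
apply: filterS ae_finite_part => x h _.
by rewrite abseM -h; congr (_ * _)%E; exact: gee0_abs.
Qed.

End finite_part.

Section distance.
Variables (R : realType) (n : nat) (E : set (Rn R n)) (b : R).
Local Notation T := (Rn R n).
Local Notation leb := (@lebesgue_Rn R n).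
Hypotheses (E0 : E !=set0) (b0 : 0 < b) (AE : A_infty (dist_pow E (- b))).

Lemma dist_set_ge0 (x : T) : 0 <= dist_set x E.
Proof.
apply: lb_le_inf; first by have [y Ey] := E0; exists (eucl_dist x y), y.
by move=> _ [y _ <-]; exact: eucl_dist_ge0.
Qed.

Let mdp : measurable_fun [set: T] (dist_pow E (- b)).
Proof. by case: AE => -[[]]. Qed.

(** The distance is a power of the measurable function [dist_pow E (- b)], also
    at its zeros because [fine +oo = 0]. *)
Lemma measurable_dist_set : measurable_fun [set: T] (fun x => dist_set x E).
Proof.
rewrite (_ : (fun x => _) = fun x => fine (dist_pow E (- b) x) `^ (- b^-1)).
  apply: measurable_fun_powR; apply: measurableT_comp mdp; exact: fine_measurable.
apply/funext => x; rewrite /dist_pow /epowR oppr_lt0 b0 andbT.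
have [->|d0] := eqVneq (dist_set x E) 0.
  by rewrite /= powR0// oppr_eq0 invr_eq0 gt_eqF.
by rewrite /= -powRrM mulrNN mulfV ?gt_eqF// powRr1// dist_set_ge0.
Qed.

Definition dist_null : set T := [set x | dist_set x E = 0].

Lemma measurable_dist_null : measurable dist_null.
Proof.
rewrite -[X in measurable X]setTI.
exact: (measurable_dist_set measurableT (measurable_set1 0)).
Qed.

(** [dist_pow E (- b)] is infinite on this set and integrable on every cube. *)
Lemma lebesgue_dist_null : leb dist_null = 0%E.
Proof.
apply/(negligibleP leb measurable_dist_null).
(* The cubes of side [2 k] centered at the origin exhaust the space. *)
pose C k : set T := cube ([tuple - k%:R | i < n] : T) (k%:R + k%:R).
have CT : dist_null `<=` \bigcup_k (C k `&` dist_null).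
  move=> x Nx; have S0 : 0 <= \sum_(i < n) `|coord x i| by apply: sumr_ge0.
  exists (Num.bound (\sum_(i < n) `|coord x i|)) => //; split => // i.
  have := archi_boundP S0; set k := _%:R => hk.
  have : `|coord x i| <= k.
    apply: ltW; apply: le_lt_trans hk; rewrite (bigD1 i)//= lerDl.
    exact: sumr_ge0.
  have cE : coord ([tuple - k | i < n] : T) i = - k by rewrite /Defs.coord tnth_mktuple.
  by rewrite cE addrA addNr add0r ler_norml.
apply: negligibleS CT _; apply: negligible_bigcup => k.
have mC : measurable (C k) by exact: measurable_cube.
have iC : leb.-integrable (C k) (dist_pow E (- b)).
  apply/integrableP; split; first exact: measurable_funTS.
  have [[[_ loc] _] _] := AE; exact: (loc _ (@compact_cube _ _ _ _)).
apply: negligibleS (integrable_ae mC iC) => x [Cx Nx] /= /(_ Cx).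
by rewrite /dist_pow /epowR Nx eqxx oppr_lt0 b0.
Qed.

(** The distance, made positive on a null set so that all its real powers are
    positive real numbers. *)
Definition delta (x : T) : R := if dist_set x E == 0 then 1 else dist_set x E.

Lemma delta_gt0 x : 0 < delta x.
Proof.
by rewrite /delta; case: ifPn => // d0; rewrite lt_neqAle eq_sym d0 dist_set_ge0.
Qed.

Lemma measurable_dist_eq0 : measurable_fun [set: T] (fun x => dist_set x E == 0).
Proof. exact: measurable_fun_eqr measurable_dist_set (measurable_cst _). Qed.

Lemma measurable_delta : measurable_fun [set: T] delta.
Proof.
apply: measurable_fun_ifT; first exact: measurable_dist_eq0.
  exact: measurable_cst.
exact: measurable_dist_set.
Qed.

Lemma dist_powE c x : ~ dist_null x -> dist_pow E c x = (delta x `^ c)%:E.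
Proof. by move=> /eqP/negbTE d0; rewrite /dist_pow /epowR /delta d0. Qed.

Lemma dist_pow_ge0 c x : (0 <= dist_pow E c x)%E.
Proof. by rewrite /dist_pow /epowR; case: ifPn => // _; rewrite lee_fin powR_ge0. Qed.

Lemma measurable_dist_pow c : measurable_fun [set: T] (dist_pow E c).
Proof.
have m2 : measurable_fun [set: T] (fun x => (dist_set x E `^ c)%:E).
  by apply/measurable_EFinP; exact: measurable_fun_powR measurable_dist_set.
rewrite /dist_pow /epowR; have [c0|c0] := boolP (c < 0); last first.
  by under eq_fun do rewrite andbF.
under eq_fun do rewrite andbT.
apply: measurable_fun_ifT m2; first exact: measurable_dist_eq0.
exact: measurable_cst.
Qed.

End distance.

Lemma potential_const_ge0 (R : realType) n (alpha p K : R) :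
  0 < alpha -> alpha < n%:R -> 1 < p -> alpha / n%:R * p < 1 -> 1 <= K ->
  0 <= potential_const n alpha p K.
Proof.
move=> a0 an p1 ap K1; have gam0 : 0 < alpha / n%:R.
  by rewrite divr_gt0// (lt_trans a0).
rewrite /potential_const mulr_ge0 ?powR_ge0// mulr_ge0 ?powR_ge0// mulr_ge0//.
rewrite /dyadic_const mulr_ge0 ?powR_ge0// mulr_ge0 ?doob_const_ge0//.
exact: muck_conj_gt1.
Qed.

Unset Implicit Arguments.

Theorem corollary1p8 (R : realType) (n : nat) (alpha p q : R)
    (E : set (Rn R n)) (beta1 beta2 : R)
    (halpha : 0 < alpha < n%:R)
    (hp : 1 < p < n%:R / alpha)
    (hq : q = n%:R * p / (n%:R - alpha * p))
    (hE : median_porous E)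
    (hdiam : (0 < diameter E < +oo)%E)
    (hbeta : - beta2 = - (q / p) * beta1)
    (hbeta2 : I_infty E (- beta2))
    (hbeta1 : I_infty E (beta1 / (p - 1))) :
  exists C : R, 0 < C /\
    forall f : Rn R n -> \bar R, measurable_fun [set: Rn R n] f ->
      ((\int[lebesgue_Rn]_x (`|frac_int alpha f x| `^ q * dist_pow E beta2 x))
          `^ q^-1
       <= C%:E *
          (\int[lebesgue_Rn]_x (`|f x| `^ p * dist_pow E beta1 x))
            `^ p^-1)%E.
Proof.
move: halpha hp hE => /andP[a0 an] /andP[p1 pna] [E0 [b b0 AE]].
have nR0 : 0 < n%:R :> R by exact: lt_trans an.
have p0 : 0 < p by exact: lt_trans p1.
have ap : alpha / n%:R * p < 1.
  by rewrite mulrAC ltr_pdivrMr// mul1r mulrC -ltr_pdivlMr.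
have apn : 0 < n%:R - alpha * p by rewrite subr_gt0 mulrC -ltr_pdivlMr.
pose gam := alpha / n%:R.
have qE : q = sobolev_exp gam p.
  by rewrite hq /sobolev_exp /gam; field; rewrite !gt_eqF//= mulrC subr_gt0 -ltr_pdivlMr.
have gam0 : 0 < gam by exact: divr_gt0.
have gpm : 0 < 1 - gam * p by rewrite subr_gt0.
have q0 : 0 < q by rewrite qE; exact: sobolev_exp_gt0.
have b2E : beta2 = q / p * beta1 by rewrite -[beta2]opprK hbeta mulNr opprK.
have dl0 := delta_gt0 E0.
have mdl := measurable_delta E0 b0 AE.
have mN := measurable_dist_null E0 b0 AE.
have N0 := lebesgue_dist_null E0 b0 AE.
pose u x := delta E x `^ beta2.
have u0 x : 0 < u x by exact: powR_gt0.
have mu_ : measurable_fun [set: Rn R n] u by exact: measurable_fun_powR.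
pose sig := dual_weight gam p u.
have sigE x : sig x = delta E x `^ (- (beta1 / (p - 1))).
  rewrite /sig /dual_weight /u -powRrM; congr (_ `^ _).
  rewrite b2E qE /sobolev_exp /dual_exp; field.
  by rewrite !gt_eqF// subr_gt0.
have sig0 x : 0 < sig x by exact: powR_gt0.
have msig : measurable_fun [set: Rn R n] sig by exact: measurable_fun_powR.
have EW1 x : ~ dist_null E x -> dist_pow E (- - beta2) x = (u x)%:E.
  by move=> Nx; rewrite opprK; exact: dist_powE.
have EW2 x : ~ dist_null E x ->
    dist_pow E (- (beta1 / (p - 1))) x = (sig x)%:E.
  by move=> Nx; rewrite sigE; exact: dist_powE.
have [uc sc [K K1 mk]] := muckenhoupt_cubes (dual_exp_gt0 p1 ap) hbeta2 hbeta1 u0 mu_ mN N0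
  EW1 EW2.
have pc0 := potential_const_ge0 a0 an p1 ap K1.
exists (potential_const n alpha p K `^ q^-1 + 1); split.
  by rewrite ltr_wpDl// powR_ge0.
move=> f mf.
have C0 : 0 <= potential_const n alpha p K `^ q^-1 by exact: powR_ge0.
(* If the right-hand integral is infinite there is nothing to prove. *)
have [Poo|Poo] := eqVneq (\int[@lebesgue_Rn R n]_x (`|f x| `^ p * dist_pow E beta1 x))%E +oo%E.
  rewrite Poo poweRyr ?invr_eq0 ?gt_eqF// gt0_muley ?leey// lte_fin.
  by rewrite ltr_wpDl.
have {}Poo : (\int[@lebesgue_Rn R n]_x (`|f x| `^ p * dist_pow E beta1 x) < +oo)%E.
  by rewrite ltey.
pose dl x := delta E x `^ beta1.
have dlE x : ~ dist_null E x -> dist_pow E beta1 x = (dl x)%:E by exact: dist_powE.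
have dl1 x : 0 < dl x by exact: powR_gt0.
have mdl1 : measurable_fun [set: Rn R n] dl by exact: measurable_fun_powR.
have mdp := measurable_dist_pow E0 b0 AE beta1.
have dp0 x := dist_pow_ge0 E beta1 x.
(* Almost everywhere [|f| = g * sig], and [g `^ p * sig = |f| `^ p * delta `^ beta1]. *)
pose g x := fine `|f x|%E / sig x.
have g0 x : 0 <= g x by rewrite divr_ge0 ?fine_ge0// ltW.
have mff : measurable_fun [set: Rn R n] (fun x => fine `|f x|%E).
  apply: (measurableT_comp (fine_measurable measurableT)).
  exact: (measurableT_comp (@abse_measurable R setT) mf).
have mg : measurable_fun [set: Rn R n] g.
  apply: (measurable_funM mff).
  have -> : (fun x => (sig x)^-1) = fun x => sig x `^ (-1).
    by apply/funext => x; rewrite powR_inv1// ltW.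
  exact: measurable_fun_powR.
have gsE x : g x * sig x = fine `|f x|%E by rewrite /g divfK// gt_eqF.
have gpE x : g x `^ p * sig x = fine `|f x|%E `^ p * dl x.
  rewrite /g powRM ?fine_ge0 ?invr_ge0 ?(ltW (sig0 x))// -mulrA; congr (_ * _).
  rewrite -[(sig x)^-1]powR_inv1 ?(ltW (sig0 x))// -powRrM.
  rewrite -{2}(powRr1 (ltW (sig0 x))) -powRD; last first.
    by rewrite (gt_eqF (sig0 x)) implybT.
  rewrite sigE -powRrM; congr (_ `^ _); field.
  by rewrite gt_eqF// subr_gt0.
have PE := integral_finite_part p0 mf mdp dp0 mdl1 dl1 mN N0 dlE Poo.
have gfun : (fun x => (g x `^ p * sig x)%:E) = (fun x => (fine `|f x|%E `^ p * dl x)%:E).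
  by apply/funext => x; rewrite gpE.
have goo : (\int[@lebesgue_Rn R n]_x (g x `^ p * sig x)%:E < +oo)%E.
  by rewrite gfun -PE.
pose X x := (`|frac_int alpha f x| `^ q * dist_pow E beta2 x)%E.
have X0 x : (0 <= X x)%E by rewrite mule_ge0 ?poweR_ge0// dist_pow_ge0.
have s0 : 0 < n%:R - alpha by rewrite subr_gt0.
have XPhi x : ~ dist_null E x -> (X x <=
    (\int[@lebesgue_Rn R n]_y riesz_term (n%:R - alpha) (fun y => (g y * sig y)%R) x y) `^ q
    * (u x)%:E)%E.
  move=> Nx; rewrite /X dist_powE//; apply: lee_wpmul2r; first by rewrite lee_fin powR_ge0.
  have h := integral_mul_finite_part p0 mf mdp dp0 dl1 mN N0 dlE Poo
    (measurable_riesz_kernel s0 x) (riesz_kernel_ge0 s0 x).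
  have gf : (fun y => (g y * sig y)%R) = (fun y => fine `|f y|%E).
    by apply/funext => y; rewrite gsE.
  rewrite gf; apply: gt0_ler_poweR; first exact: ltW.
  - by rewrite in_itv/= abse_ge0 leey.
  - rewrite in_itv/= leey andbT; apply: integral_ge0 => y _.
    by apply: riesz_term_ge0 => // z; rewrite fine_ge0.
  - exact: h.
rewrite qE in XPhi.
have main := potential_bound a0 an p1 ap K1 mu_ u0 uc sc mk mg g0 goo mN N0 X0 XPhi.
set P := fine _ in main.
have P0 : 0 <= P.
  by apply: fine_ge0; apply: integral_ge0_real => x; rewrite mulr_ge0 ?powR_ge0// ltW.
have PfE : (\int[@lebesgue_Rn R n]_x (`|f x| `^ p * dist_pow E beta1 x) = P%:E)%E.
  rewrite PE -gfun /P fineK// ge0_fin_numE; first exact: goo.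
  by apply: integral_ge0_real => x; rewrite mulr_ge0 ?powR_ge0// ltW.
rewrite PfE poweR_EFin -EFinM.
have IX0 : (0 <= \int[@lebesgue_Rn R n]_x X x)%E by apply: integral_ge0 => x _.
have qi0 : 0 <= q^-1 by rewrite invr_ge0 ltW.
rewrite -qE in main.
have R0 : 0 <= potential_const n alpha p K * P `^ (q / p).
  by rewrite mulr_ge0 ?powR_ge0.
apply: le_trans (gt0_ler_poweR qi0 _ _ main) _.
- by rewrite in_itv/= IX0 leey.
- by rewrite in_itv/= leey andbT lee_fin.
rewrite poweR_EFin lee_fin powRM ?powR_ge0// -powRrM.
have -> : q / p * q^-1 = p^-1 by field; rewrite !gt_eqF.
by rewrite ler_wpM2r ?powR_ge0// lerDl.
Qed.
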